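(* There is an absolute constant $C>0$ such that the following holds. Let $G=(V,E)$ be a finite, simple, undirected, connected, vertex-transitive graph with $N$ vertices whose Laplacian matrix $L$ has only integer eigenvalues, and let $d_L$ be the integer defined in the context below. Let $m\in V$ be any vertex (the marked vertex) and let $|s\rangle=\frac{1}{\sqrt N}\sum_{v\in V}|v\rangle$. Then there exist an integer $p\le C\,2^{d_L-1}\sqrt N$ and real numbers $\gamma,\theta_1,\dots,\theta_p,t_1,\dots,t_p$ such that $$|s\rangle=e^{-i\gamma}\prod_{k=1}^{p}e^{-i\theta_k|m\rangle\langle m|}\,e^{-iLt_k}\,|m\rangle .$$
   Context: Work in the Hilbert space $\mathcal H=\mathrm{span}\{|v\rangle : v\in V\}$ with orthonormal vertex basis. The Laplacian is $L=D-A$, where $D$ is the diagonal degree matrix and $A$ the adjacency matrix of $G$. A graph is vertex transitive if for any two vertices $v_1,v_2$ there is a graph automorphism mapping $v_1$ to $v_2$. The product $\prod_{k=1}^p X_k$ denotes the ordered product $X_p X_{p-1}\cdots X_1$ (so $X_1$ acts first). For a finite multiset $S$ of integers, $\gcd(S)$ denotes the greatest common divisor of the nonzero elements of $S$, with $\gcd(S)=1$ if $S$ has no nonzero element. Let $\Lambda_0$ be the multiset of eigenvalues $\lambda_1,\dots,\lambda_N$ of $L$ (counted with multiplicity; $0$ is among them). Recursively, for $k\ge 0$ let $\Lambda_{k+1}=\{\lambda\in\Lambda_k : e^{-i\lambda\pi/\gcd(\Lambda_k)}=1\}$, i.e. the elements $\lambda$ of $\Lambda_k$ for which $\lambda/\gcd(\Lambda_k)$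 is even. Then $d_L$ is the least $k$ such that $\Lambda_k$ contains only the eigenvalue $0$. *)

(* Defs.v *)
From HB Require Import structures.
From mathcomp Require Import all_boot all_order all_algebra.
From mathcomp Require Import perm complex.
From mathcomp Require Import all_classical all_reals all_analysis.
Import Order.TTheory GRing.Theory Num.Theory ComplexField.
Import numFieldTopology.Exports numFieldNormedType.Exports.

Set Implicit Arguments.
Unset Strict Implicit.
Unset Printing Implicit Defensive.

Local Open Scope ring_scope.
Local Open Scope classical_set_scope.

Definition simple_graph (n : nat) (e : rel 'I_n) : Prop :=
  symmetric e /\ irreflexive e.

Definition connected_graph (n : nat) (e : rel 'I_n) : Prop :=
  forall x y : 'I_n, connect e x y.

Definition vertex_transitive (n : nat) (e : rel 'I_n) : Prop :=
  forall x y : 'I_n, exists f : {perm 'I_n},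
    f x = y /\ (forall a b : 'I_n, e (f a) (f b) = e a b).

Definition degree (n : nat) (e : rel 'I_n) (a : 'I_n) : nat := #|[set b | e a b]|.

Definition laplacian (n : nat) (e : rel 'I_n) : 'M[int]_n :=
  \matrix_(a, b) ((a == b)%:R * (degree e a)%:R - (e a b)%:R).

Definition gcdS (s : seq int) : nat :=
  let g := foldr gcdn 0%N [seq `|x|%N | x <- s] in if g == 0%N then 1%N else g.

Definition stepL (s : seq int) : seq int :=
  [seq x <- s | ~~ odd (`|x|%N %/ gcdS s)].

Definition Lam (k : nat) (s : seq int) : seq int := iter k stepL s.

Definition only_zero (s : seq int) : bool := all (fun x => x == 0) s.

(* d_L = least k such that Lambda_k contains only 0.  The search range
   0 .. (sum |x|) always contains such a k (each step at least doubles the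
   gcd of the remaining nonzero elements), so this is the true minimum. *)
Definition dL (s : seq int) : nat :=
  find (fun k => only_zero (Lam k s)) (iota 0 (\sum_(x <- s) `|x|%N).+1).

Definition cexp (R : realType) (z : R[i]) : R[i] :=
  limn (fun N => (\sum_(k < N) (k`!%:R)^-1 * z ^+ k : R[i]) : (R[i])^o).

Definition mexp (R : realType) (n : nat) (A : 'M[R[i]]_n) : 'M[R[i]]_n :=
  \matrix_(a, b)
    limn (fun N => ((\sum_(k < N) (k`!%:R)^-1 *: A ^+ k) a b : R[i]) : (R[i])^o).

Definition ket (R : realType) (n : nat) (v : 'I_n) : 'cV[R[i]]_n := delta_mx v 0.

Definition proj1 (R : realType) (n : nat) (v : 'I_n) : 'M[R[i]]_n := delta_mx v v.

Definition ket_s (R : realType) (n : nat) : 'cV[R[i]]_n :=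
  ((Num.sqrt (n%:R : R))^-1)%:C%C *: const_mx 1.

Definition laplacianC (R : realType) (n : nat) (e : rel 'I_n) : 'M[R[i]]_n :=
  map_mx (fun z : int => z%:~R) (laplacian e).

(* Main.v *)
(* Write U(t) = exp(- i t L) and m_a = U(a) |m>.  Conjugating a phase on |m> by the
   evolution gives a phase on m_a, which changes a vector by a prescribed multiple
   of m_a as long as its norm is preserved.  For |z| <= 1 and m_a, m_b not nearly
   orthogonal, three such phases turn z + c m_a into some z + c' m_b: the amplitude
   not yet used can hop along the orbit of m, and leaves pieces w m_a behind
   whenever |z| stays at most 1.
     Since the eigenvalues are integers, the sum of the m_a over the 2 ^ d_L subset
   sums a of the times pi / gcd(Lambda_k) is invariant under the evolution, hence a
   multiple of s.  So s is a combination of pieces, laid out in about sqrt (N / d)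
   rounds of 2 ^ d_L stops, where d is the degree of m.  At each stop the pieces are
   placed in pairs at a and a + pi / d: since U(pi / d) |m> is close to - |m>, each
   pair is short and so keeps the norm of z below 1.  A stop costs O(sqrt d)
   phases, hence O(2 ^ d_L sqrt N) in total; gamma = 0 suffices. *)
Require Import Defs.
From HB Require Import structures.
From mathcomp Require Import all_boot all_order all_algebra.
From mathcomp Require Import perm complex.
From mathcomp Require Import all_classical all_reals all_analysis.
From mathcomp Require Import ring lra.
Import Order.TTheory GRing.Theory Num.Theory ComplexField.
Import numFieldTopology.Exports numFieldNormedType.Exports.

Set Implicit Arguments.
Unset Strict Implicit.
Unset Printing Implicit Defensive.
Local Open Scope ring_scope.

(** * Hopping coefficients *)

Lemma cos_sin_surj (R : realType) (a b : R) : a ^+ 2 + b ^+ 2 = 1 ->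
  exists t : R, cos t = a /\ sin t = b.
Proof.
move=> ab.
have a1 : -1 <= a <= 1 by apply/andP; split; nra.
have sE : sin (acos a) = `|b|.
  by rewrite sin_acos// -sqrtr_sqr; congr Num.sqrt; rewrite -ab; ring.
have cE : cos (acos a) = a by apply: acosK; rewrite in_itv.
have [b0|b0] := ltrP b 0.
  by exists (- acos a); rewrite cosN sinN cE sE ltr0_norm// opprK.
by exists (acos a); rewrite cE sE ger0_norm.
Qed.

(* [c], [z] complex with
   |c|^2 + 2 Re (c^* o) = g, |z|^2 + 2 Re (z^* q) = g, Re (c^* z k) = - g / 2,
   in real coordinates *)
Lemma hop_coefs_wlog (R : realType) (g o1 o2 q1 q2 k1 k2 : R) :
  0 <= g -> 1 <= 4 * (k1 ^+ 2 + k2 ^+ 2) -> q1 ^+ 2 + q2 ^+ 2 <= o1 ^+ 2 + o2 ^+ 2 ->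
  exists c1 c2 z1 z2 : R,
  [/\ c1 ^+ 2 + c2 ^+ 2 + 2 * (c1 * o1 + c2 * o2) = g,
      z1 ^+ 2 + z2 ^+ 2 + 2 * (z1 * q1 + z2 * q2) = g
    & 2 * ((c1 * z1 + c2 * z2) * k1 - (c1 * z2 - c2 * z1) * k2) = - g].
Proof.
move=> g0 k4 qo.
have [{g0}->|gN0] := eqVneq g 0.
  by exists 0, 0, 0, 0; split; ring.
have {gN0}g0 : 0 < g by rewrite lt_neqAle eq_sym gN0.
pose ro := Num.sqrt (o1 ^+ 2 + o2 ^+ 2); pose rh := Num.sqrt (g + ro ^+ 2).
have ro0 : 0 <= ro by exact: sqrtr_ge0.
have ro2 : ro ^+ 2 = o1 ^+ 2 + o2 ^+ 2 by rewrite sqr_sqrtr//; nra.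
have rh0 : 0 <= rh by exact: sqrtr_ge0.
have rh2 : rh ^+ 2 = g + ro ^+ 2 by rewrite sqr_sqrtr//; nra.
(* The first equation puts [c] on the circle of centre [- o] and radius [rh]; its point farthest
   from the origin, of modulus [rh + ro], is taken. *)
have [c1 [c2 [cE cn]]] : exists c1 c2 : R,
   c1 ^+ 2 + c2 ^+ 2 + 2 * (c1 * o1 + c2 * o2) = g /\
   c1 ^+ 2 + c2 ^+ 2 = (rh + ro) ^+ 2.
  have [r0|rN0] := eqVneq ro 0.
    have [E1 E2] : o1 = 0 /\ o2 = 0.
      by move: ro2; rewrite r0 => h; split; nra.
    by exists rh, 0; rewrite E1 E2 r0; split; nra.
  pose k := - (1 + rh / ro).
  have kro : k * ro = - (rh + ro) by rewrite /k; field.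
  exists (k * o1), (k * o2).
  have E : (k * o1) ^+ 2 + (k * o2) ^+ 2 = (rh + ro) ^+ 2.
    by rewrite -[(rh + ro) ^+ 2]sqrrN -kro !exprMn -mulrDr -ro2.
  split; rewrite E//.
  have -> : k * o1 * o1 + k * o2 * o2 = k * ro * ro.
    by rewrite -(mulrA k ro) -expr2 ro2; ring.
  by rewrite kro; nra.
(* [w = c k^*]; on the line Re (w^* z) = - g / 2 the second equation is a
   quadratic, with nonnegative discriminant thanks to [|w| >= (rh + ro) / 2] *)
pose w1 := c1 * k1 + c2 * k2; pose w2 := c2 * k1 - c1 * k2.
pose W := w1 ^+ 2 + w2 ^+ 2.
have WE : W = (rh + ro) ^+ 2 * (k1 ^+ 2 + k2 ^+ 2).
  by rewrite -cn /W /w1 /w2; ring.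
have rr : (rh - ro) * (rh + ro) = g by nra.
have srr : 0 < rh + ro.
  have : 0 <= rh + ro by exact: addr_ge0.
  rewrite le_eqVlt => /orP[/eqP h|//].
  by move: g0; rewrite -rr -h mulr0 ltxx.
have W4 : (rh + ro) ^+ 2 <= 4 * W.
  rewrite WE mulrCA -[leLHS]mulr1 ler_pM2l// exprn_gt0//.
have W0 : 0 < W.
  have := exprn_gt0 2 srr; lra.
(* z = (x + i y) w *)
pose x := - g / (2 * W).
pose h := w1 * q1 + w2 * q2.   (* Re (w^* q) *)
pose l := w1 * q2 - w2 * q1.   (* Im (w^* q) *)
have hl : h ^+ 2 + l ^+ 2 = W * (q1 ^+ 2 + q2 ^+ 2).
  by rewrite /h /l /W; ring.
have xW : 2 * (x * W) = - g by rewrite /x; field; rewrite gt_eqF.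
suff [y yE] : exists y : R, (x ^+ 2 + y ^+ 2) * W + 2 * (x * h + y * l) = g.
  exists c1, c2, (x * w1 - y * w2), (x * w2 + y * w1); split=> //.
    by rewrite -yE /W /h /l; ring.
  by rewrite -xW /W /w1 /w2; ring.
(* Up to [l ^+ 2] this is g (W - g / 4 + h), where h >= - |w| ro by Cauchy-Schwarz and [qo]. As g =
   (rh - ro) (rh + ro), the bracket is nonnegative once |w| >= (rh + ro) / 2. *)
have key : l ^+ 2 - W * (x ^+ 2 * W + 2 * (x * h) - g) >= 0.
  have -> : l ^+ 2 - W * (x ^+ 2 * W + 2 * (x * h) - g) =
     l ^+ 2 + W * g - (x * W) ^+ 2 - 2 * (x * W) * h by ring.
  have -> : x * W = - g / 2 by lra.
  suff : 0 <= W * g - (g / 2) ^+ 2 + g * h by nra.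
  pose rW := Num.sqrt W.
  have rW0 : 0 <= rW by exact: sqrtr_ge0.
  have rW2 : rW ^+ 2 = W by rewrite sqr_sqrtr// ltW.
  have rWs : rh + ro <= 2 * rW.
    rewrite -(@ler_pXn2r _ 2) ?nnegrE ?mulr_ge0// ?(ltW srr)//.
    by rewrite exprMn rW2; lra.
  have hh : - (rW * ro) <= h.
    have : h ^+ 2 <= (rW * ro) ^+ 2.
      rewrite exprMn rW2 ro2.
      have := ler_wpM2l (ltW W0) qo; have := sqr_ge0 l; lra.
    move=> H; rewrite lerNl; apply: (le_trans (ler_norm _)).
    rewrite normrN -(@ler_pXn2r _ 2) ?nnegrE ?normr_ge0 ?mulr_ge0//.
    by rewrite real_normK// num_real.
  have -> : W * g - (g / 2) ^+ 2 + g * h = g * (W - g / 4 + h) by field.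
  apply: mulr_ge0; first exact: ltW.
  have rhro : ro <= rh by rewrite -subr_ge0 -(pmulr_lge0 _ srr) rr ltW.
  have A : 0 <= rW - ro - (rh - ro) / 2 by lra.
  have B : 0 <= (rh - ro) * (2 * rW - (rh + ro)) by rewrite mulr_ge0 ?subr_ge0.
  have := mulr_ge0 rW0 A; rewrite -rW2 -rr; lra.
exists ((- l + Num.sqrt (l ^+ 2 - W * (x ^+ 2 * W + 2 * (x * h) - g))) / W).
set s := Num.sqrt _.
have s2 : s ^+ 2 = l ^+ 2 - W * (x ^+ 2 * W + 2 * (x * h) - g) by rewrite sqr_sqrtr.
have WN0 : W != 0 by rewrite gt_eqF.
apply/eqP; rewrite -subr_eq0; apply/eqP.
have -> : (x ^+ 2 + ((- l + s) / W) ^+ 2) * W + 2 * (x * h + (- l + s) / W * l) - g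
  = (s ^+ 2 - (l ^+ 2 - W * (x ^+ 2 * W + 2 * (x * h) - g))) / W by field.
by rewrite s2 subrr mul0r.
Qed.

(** * Real inner product on complex vectors *)

(** Exchanging (c, o) with (z, q) only changes the sign of [k2], so |q| <= |o| may be assumed. *)
Lemma hop_coefs (R : realType) (g o1 o2 q1 q2 k1 k2 : R) :
  0 <= g -> 1 <= 4 * (k1 ^+ 2 + k2 ^+ 2) ->
  exists c1 c2 z1 z2 : R,
  [/\ c1 ^+ 2 + c2 ^+ 2 + 2 * (c1 * o1 + c2 * o2) = g,
      z1 ^+ 2 + z2 ^+ 2 + 2 * (z1 * q1 + z2 * q2) = g
    & 2 * ((c1 * z1 + c2 * z2) * k1 - (c1 * z2 - c2 * z1) * k2) = - g].
Proof.
move=> g0 k4.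
have [qo|/ltW oq] := lerP (q1 ^+ 2 + q2 ^+ 2) (o1 ^+ 2 + o2 ^+ 2).
  exact: hop_coefs_wlog.
have k4' : 1 <= 4 * (k1 ^+ 2 + (- k2) ^+ 2) by rewrite sqrrN.
have [z1 [z2 [c1 [c2 [zE cE czE]]]]] := hop_coefs_wlog g0 k4' oq.
by exists c1, c2, z1, z2; split=> //; rewrite -czE; ring.
Qed.

Lemma Re_mul (R : realType) (x y : R[i]) :
  complex.Re (x * y) = complex.Re x * complex.Re y - complex.Im x * complex.Im y.
Proof. by case: x; case: y. Qed.

Lemma Im_mul (R : realType) (x y : R[i]) :
  complex.Im (x * y) = complex.Re x * complex.Im y + complex.Im x * complex.Re y.
Proof. by case: x; case: y. Qed.

Lemma Re_add (R : realType) (x y : R[i]) :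
  complex.Re (x + y) = complex.Re x + complex.Re y.
Proof. by case: x; case: y. Qed.

Lemma Im_add (R : realType) (x y : R[i]) :
  complex.Im (x + y) = complex.Im x + complex.Im y.
Proof. by case: x; case: y. Qed.

Section Vectors.
Context (R : realType) (n : nat).
Implicit Types (u v w z : 'cV[R[i]]_n) (a b c : R).

(* real and imaginary part of the Hermitian product [<u|v>] *)
Definition rdot u v : R :=
  \sum_i (complex.Re (u i 0) * complex.Re (v i 0)
          + complex.Im (u i 0) * complex.Im (v i 0)).
Definition idot u v : R :=
  \sum_i (complex.Re (u i 0) * complex.Im (v i 0)
          - complex.Im (u i 0) * complex.Re (v i 0)).
Definition nsq u : R := rdot u u.

Lemma rdotC u v : rdot u v = rdot v u.
Proof. by apply: eq_bigr => i _; ring. Qed.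

Lemma idotC u v : idot u v = - idot v u.
Proof. by rewrite -sumrN; apply: eq_bigr => i _; ring. Qed.

Lemma rdotDr u v w : rdot u (v + w) = rdot u v + rdot u w.
Proof.
by rewrite -big_split; apply: eq_bigr => i _ /=; rewrite mxE Re_add Im_add; ring.
Qed.

Lemma idotDr u v w : idot u (v + w) = idot u v + idot u w.
Proof.
by rewrite -big_split; apply: eq_bigr => i _ /=; rewrite mxE Re_add Im_add; ring.
Qed.

Lemma rdotZr u v a b :
  rdot u ((a +i* b)%C *: v) = a * rdot u v - b * idot u v.
Proof.
rewrite !mulr_sumr -sumrB; apply: eq_bigr => i _ /=.
by rewrite mxE Re_mul Im_mul /=; ring.
Qed.

Lemma idotZr u v a b :
  idot u ((a +i* b)%C *: v) = a * idot u v + b * rdot u v.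
Proof.
rewrite !mulr_sumr -big_split; apply: eq_bigr => i _ /=.
by rewrite mxE Re_mul Im_mul /=; ring.
Qed.

Lemma rdot0r u : rdot u 0 = 0.
Proof. by apply: big1 => i _; rewrite mxE /= !mulr0 addr0. Qed.

Lemma idot0r u : idot u 0 = 0.
Proof. by apply: big1 => i _; rewrite mxE /= !mulr0 subr0. Qed.

Lemma rdotDl u v w : rdot (v + w) u = rdot v u + rdot w u.
Proof. by rewrite rdotC rdotDr !(rdotC u). Qed.

Lemma rdotZl u v a b : rdot ((a +i* b)%C *: v) u = a * rdot v u + b * idot v u.
Proof. by rewrite rdotC rdotZr rdotC (idotC u); ring. Qed.

Lemma rdot_scaler u v a : rdot u (a%:C%C *: v) = a * rdot u v.
Proof. by rewrite -complexr0 rdotZr mul0r subr0. Qed.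

Lemma nsq_ge0 u : 0 <= nsq u.
Proof. by apply: sumr_ge0 => i _; rewrite -!expr2 addr_ge0// sqr_ge0. Qed.

Lemma nsqD u v : nsq (u + v) = nsq u + nsq v + 2 * rdot u v.
Proof. by rewrite /nsq rdotDr !rdotDl (rdotC v u); ring. Qed.

Lemma idot_self u : idot u u = 0.
Proof. by apply/eqP; rewrite -[_ == 0](mulrn_eq0 _ 2) mulr2n {1}idotC addNr. Qed.

Lemma nsqZ v a b : nsq ((a +i* b)%C *: v) = (a ^+ 2 + b ^+ 2) * nsq v.
Proof.
by rewrite /nsq rdotZr (idotC (_ *: v)) idotZr rdotZl idot_self; ring.
Qed.

Lemma nsq_scaler v a : nsq (a%:C%C *: v) = a ^+ 2 * nsq v.
Proof. by rewrite -complexr0 nsqZ expr0n addr0. Qed.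

Lemma nsqDZ u v a b : nsq (u + (a +i* b)%C *: v) =
  nsq u + (a ^+ 2 + b ^+ 2) * nsq v + 2 * (a * rdot v u + b * idot v u).
Proof. by rewrite nsqD nsqZ rdotZr (rdotC u) (idotC u); ring. Qed.

Lemma nsq_eq0 u : nsq u = 0 -> u = 0.
Proof.
move=> /eqP; rewrite psumr_eq0 => [/allP u0|i _]; last first.
  by rewrite -!expr2 addr_ge0// sqr_ge0.
apply/matrixP => i j; rewrite ord1 mxE; move: (u0 i (mem_index_enum i)) => /=.
rewrite -!expr2 paddr_eq0 ?sqr_ge0// !sqrf_eq0 => /andP[/eqP r0 /eqP i0].
by case: (u i 0) r0 i0 => x y /= -> ->.
Qed.

(** Cauchy-Schwarz, from the square of b u - a v; zero bounds are treated apart because [a * b] is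
    cancelled at the end. *)
Lemma rdot_le u v a b : 0 <= a -> 0 <= b -> nsq u <= a ^+ 2 -> nsq v <= b ^+ 2 ->
  rdot u v <= a * b.
Proof.
rewrite le_eqVlt => /orP[/eqP <- _|a0].
  rewrite expr0n /= => u0 _; rewrite mul0r.
  have -> : u = 0 by apply: nsq_eq0; apply/eqP; rewrite eq_le u0 nsq_ge0.
  by rewrite rdotC rdot0r.
rewrite le_eqVlt => /orP[/eqP <- _|b0].
  rewrite expr0n /= => v0; rewrite mulr0.
  have -> : v = 0 by apply: nsq_eq0; apply/eqP; rewrite eq_le v0 nsq_ge0.
  by rewrite rdot0r.
move=> ua vb; have := nsq_ge0 (b%:C%C *: u + (- a)%:C%C *: v).
rewrite nsqD !nsq_scaler rdot_scaler rdotC rdot_scaler (rdotC v).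
have := ler_wpM2l (sqr_ge0 a) vb; have := ler_wpM2l (sqr_ge0 b) ua.
move=> h1 h2 h3; rewrite -(ler_pM2l (mulr_gt0 a0 b0)); lra.
Qed.

Lemma nsqD_le u v a b : 0 <= a -> 0 <= b -> nsq u <= a ^+ 2 -> nsq v <= b ^+ 2 ->
  nsq (u + v) <= (a + b) ^+ 2.
Proof. by move=> a0 b0 ua vb; have := rdot_le a0 b0 ua vb; rewrite nsqD; nra. Qed.

(* [exp(- i t |v><v|) x] for a unit vector [v] *)
Definition phase v t u : 'cV[R[i]]_n :=
  u + (((cos t - 1) -i* sin t)%C * (rdot v u +i* idot v u)%C : R[i]) *: v.

(** Norm preservation means that <v|u> + c and <v|u> have equal modulus, so their quotient is some
    exp(- i t). If <v|u> = 0, then c = 0. *)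
Lemma phase_surj v u (c : R[i]) : nsq v = 1 -> nsq (u + c *: v) = nsq u ->
  exists t, phase v t u = u + c *: v.
Proof.
case: c => c1 c2 v1; rewrite nsqDZ v1 /phase.
set p := rdot v u; set q := idot v u => cE.
have [D0|DN0] := eqVneq (p ^+ 2 + q ^+ 2) 0.
  have [p0 q0] : p = 0 /\ q = 0 by split; nra.
  have [c10 c20] : c1 = 0 /\ c2 = 0 by move: cE; rewrite p0 q0 => ?; split; nra.
  exists 0; rewrite p0 q0 c10 c20; congr (_ + _ *: _).
  by apply/eqP; rewrite eq_complex Re_mul Im_mul /= !mulr0 !addr0 subrr !eqxx.
(* The real part and minus the imaginary part of that quotient. *)
have [|t [ct st]] := @cos_sin_surj R (((p + c1) * p + (q + c2) * q) / (p ^+ 2 + q ^+ 2))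
    (- ((q + c2) * p - (p + c1) * q) / (p ^+ 2 + q ^+ 2)).
  have E : (p + c1) ^+ 2 + (q + c2) ^+ 2 = p ^+ 2 + q ^+ 2 by nra.
  transitivity (((p + c1) ^+ 2 + (q + c2) ^+ 2) / (p ^+ 2 + q ^+ 2)).
    by field.
  by rewrite E divff.
exists t; congr (_ + _ *: _); apply/eqP; rewrite eq_complex Re_mul Im_mul /= ct st.
by apply/andP; split; apply/eqP; field.
Qed.

Lemma rdot_ket (m : 'I_n) u : rdot (delta_mx m 0) u = complex.Re (u m 0).
Proof.
rewrite /rdot (bigD1 m)//= big1 ?addr0 => [|i /negPf im].
  by rewrite mxE !eqxx /=; ring.
by rewrite mxE im /=; ring.
Qed.

Lemma idot_ket (m : 'I_n) u : idot (delta_mx m 0) u = complex.Im (u m 0).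
Proof.
rewrite /idot (bigD1 m)//= big1 ?addr0 => [|i /negPf im].
  by rewrite mxE !eqxx /=; ring.
by rewrite mxE im /=; ring.
Qed.

Lemma dotE u v : (rdot u v +i* idot u v)%C = ((map_mx conjc u)^T *m v) 0 0.
Proof.
rewrite mxE; under eq_bigr do rewrite !mxE.
rewrite /rdot /idot; elim/big_ind3 : _ => //= [x1 x2 x3 y1 y2 y3 <- <- //|i _].
by case: (u i 0) (v i 0) => [a b] [c d]; apply/eqP; rewrite eq_complex /=;
  apply/andP; split; apply/eqP; ring.
Qed.

Lemma nsqE u : nsq u = rdot u u. Proof. by []. Qed.

Lemma nsq_sum u : nsq u = \sum_i (complex.Re (u i 0) ^+ 2 + complex.Im (u i 0) ^+ 2).
Proof. by apply: eq_bigr => i _; rewrite -!expr2. Qed.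

Lemma nsq0 : nsq 0 = 0. Proof. exact: rdot0r. Qed.

Lemma phaseE v t u : phase v t u =
  u + (((cos t - 1) -i* sin t)%C * (rdot v u +i* idot v u)%C : R[i]) *: v.
Proof. by []. Qed.

End Vectors.

#[global] Opaque rdot idot nsq phase.

(** * Walks along the orbit of the marked vertex *)

(* The right-hand side of [nsq_target] when [l] of the [L] rounds remain after the
   current one.  For [0 < l] the last square is at most [(l / L) ^ 2]; in the
   last round it is absorbed by the linear term. *)
Lemma safe_coefs (R : realType) (eps nu a L : R) (M J l i : nat) (B : R) :
  0 <= eps -> 0 < nu -> (0 < M)%N -> (0 < J)%N -> 0 < L -> l%:R < L -> (i <= J)%N ->
  a = (2 * l%:R + 1) / L ^+ 2 / (nu * M%:R * J%:R * (J%:R + 1)) ->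
  3 * (eps / (2 * nu) + 1 / (nu * M%:R * (J%:R + 1))) <= L ->
  2 <= nu ^+ 2 * L ^+ 2 * J%:R * (J%:R + 1) ->
  a * (i%:R * (i%:R - 1)) / 2 <= B -> 0 <= B ->
  B <= (2 * l%:R + 1) / L ^+ 2 / (2 * nu) ->
  forall x : R, x = 1 - (l%:R / L) ^+ 2 ->
  x ^+ 2 - 2 * x * (2 * nu * B + nu * (a * i%:R)) + (eps * B + a * i%:R) ^+ 2 <= 1.
Proof.
move=> e0 nu0 M0 J0 L0 lL iJ aE H1 H2 iB B0 BW.
(* This is ((l + 1) / L) ^ 2 - (l / L) ^ 2, the share of [s] laid out in the current round. *)
set de := (2 * l%:R + 1) / L ^+ 2 in aE BW.
have M1 : 1 <= M%:R :> R by rewrite ler1n.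
have J1 : 1 <= J%:R :> R by rewrite ler1n.
have iR : i%:R <= J%:R :> R by rewrite ler_nat.
have i0 : 0 <= i%:R :> R by exact: ler0n.
have l0 : 0 <= l%:R :> R by exact: ler0n.
have L2 : 0 < L ^+ 2 by exact: exprn_gt0.
have de0 : 0 < de by rewrite divr_gt0//; lra.
have D0 : 0 < nu * M%:R * J%:R * (J%:R + 1) by rewrite !mulr_gt0//; lra.
have a0 : 0 < a by rewrite aE divr_gt0.
have aJ : a * i%:R <= de * (1 / (nu * M%:R * (J%:R + 1))).
  apply: (@le_trans _ _ (a * J%:R)); first by rewrite ler_pM2l.
  by rewrite aE le_eqVlt; apply/orP; left; apply/eqP; field; rewrite !gt_eqF//; lra.
have eB : eps * B <= de * (eps / (2 * nu)).
  have -> : de * (eps / (2 * nu)) = eps * (de / (2 * nu)) by field; rewrite gt_eqF.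
  exact: ler_wpM2l.
set u := l%:R / L; have uL : u * L = l%:R by rewrite /u divfK// gt_eqF.
have u0 : 0 <= u by rewrite divr_ge0// ltW.
have u1 : u < 1 by rewrite ltr_pdivrMr// mul1r.
move=> x xE; have x0 : 0 <= x by rewrite xE; nra.
have ai0 : 0 <= a * i%:R by rewrite mulr_ge0// ltW.
have [lE|l1] : l = 0%N \/ 1 <= l%:R :> R.
  by case: (posnP l) => [|h]; [left|right; rewrite ler1n].
  have x1 : x = 1 by rewrite xE /u lE mul0r expr0n subr0.
  have deE : de = 1 / L ^+ 2 by rewrite /de lE mulr0 add0r.
  rewrite x1.
  have P1 : 0 < 1 / (nu * M%:R * (J%:R + 1)) by rewrite divr_gt0// !mulr_gt0//; lra.
  have e2 : eps ^+ 2 <= nu ^+ 2 * L ^+ 2.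
    rewrite -exprMn ler_pXn2r// ?nnegrE//; last by rewrite mulr_ge0// ltW.
    have : eps / (2 * nu) * (2 * nu) = eps by rewrite divfK// gt_eqF// mulr_gt0.
    set y := eps / (2 * nu) in H1 *; set z := 1 / _ in P1 H1 => <-.
    have yL : y <= L / 3 by lra.
    have := ler_wpM2r (ltW nu0) yL; have := mulr_gt0 nu0 L0; lra.
  have eeB : eps ^+ 2 * B <= nu / 2.
    have h1 := ler_wpM2r B0 e2; apply: (le_trans h1).
    have h2 := ler_wpM2l (mulr_ge0 (sqr_ge0 nu) (sqr_ge0 L)) BW.
    apply: (le_trans h2); rewrite deE le_eqVlt; apply/orP; left; apply/eqP.
    by field; rewrite !gt_eqF.
  have an : a <= nu / 2.
    rewrite aE deE ler_pdivrMr// ler_pdivrMr//.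
    have h := mulr_ge0 (mulr_ge0 (sqr_ge0 nu) (sqr_ge0 L)) (ltW (lt_le_trans ltr01 J1)).
    have h' : 0 <= J%:R + 1 :> R by lra.
    have := mulr_ge0 (mulr_ge0 h h') (_ : 0 <= M%:R - 1); rewrite subr_ge0 => /(_ M1).
    nra.
  (* The order of the pieces enters here: by [iB], B dominates a i (i - 1) / 2, so with a <= nu / 2
     the linear terms pay for the square of the current piece. *)
  have w2 : (a * i%:R) ^+ 2 <= nu * B + nu * (a * i%:R).
    have : 0 <= (nu / 2 - a) * (a * i%:R * i%:R).
      by rewrite mulr_ge0 ?subr_ge0// mulr_ge0.
    have := ler_wpM2l (ltW nu0) iB; have := mulr_ge0 (ltW nu0) ai0; lra.
  have := sqr_ge0 (eps * B - a * i%:R); have := ler_wpM2r B0 eeB; nra.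
(* With at least one round left, 2 l + 1 <= 3 l; this is the source of the factor 3 in [H1]. *)
have ls : eps * B + a * i%:R <= u.
  have d3 : de <= 3 * l%:R / L ^+ 2 by rewrite ler_pM2r ?invr_gt0//; lra.
  apply: le_trans (lerD eB aJ) _; rewrite -mulrDr.
  set y := _ + _ in H1 *.
  have y0 : 0 <= y by apply: addr_ge0; rewrite divr_ge0// !mulr_ge0//; lra.
  apply: (le_trans (ler_wpM2r y0 d3)).
  rewrite mulrAC ler_pdivrMr// expr2 mulrA uL.
  have := ler_wpM2l l0 H1; lra.
have xx : x ^+ 2 + u ^+ 2 <= 1.
  have -> : x ^+ 2 + u ^+ 2 = 1 - u ^+ 2 * (1 - u ^+ 2) by rewrite xE; ring.
  have : 0 <= u ^+ 2 * (1 - u ^+ 2) by rewrite mulr_ge0 ?sqr_ge0//; nra.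
  lra.
have P : (eps * B + a * i%:R) ^+ 2 <= u ^+ 2.
  by rewrite ler_pXn2r// nnegrE ?addr_ge0// mulr_ge0.
have : 0 <= x * (2 * nu * B + nu * (a * i%:R)).
  by rewrite mulr_ge0// addr_ge0// !mulr_ge0// ltW.
lra.
Qed.

Lemma addr_swap (V : zmodType) (x y w : V) : x + y + (w - y) = x + w.
Proof. by rewrite addrACA subrr addr0. Qed.

Section Walk.
Context (R : realType) (n : nat) (m : 'cV[R[i]]_n) (U : R -> 'M[R[i]]_n).
Context (m1 : nsq m = 1) (U0 : U 0 = 1%:M)
  (UD : forall s t, U (s + t) = U s *m U t)
  (Ur : forall t u v, rdot (U t *m u) (U t *m v) = rdot u v).
Implicit Types (x z : 'cV[R[i]]_n) (a b s t : R) (p : nat).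

Inductive reach : nat -> 'cV[R[i]]_n -> Prop :=
| reach0 : reach 0 m
| reachS p x s t : reach p x -> reach p.+1 (phase m s (U t *m x)).

(** Up to a final evolution, steps become phases at arbitrary points of the orbit. *)
Definition reach_evol p x := exists t, reach p (U t *m x).

Local Notation orb a := (U a *m m).

Lemma idot_U t u v : idot (U t *m u) (U t *m v) = idot u v.
Proof.
have idotE w w' : idot w w' = - rdot w ((0 +i* 1)%C *: w').
  by rewrite rdotZr mul0r mul1r sub0r opprK.
by rewrite !idotE scalemxAr Ur.
Qed.

Lemma phase_evol a v t x : U a *m phase v t x = phase (U a *m v) t (U a *m x).
Proof. by rewrite !phaseE mulmxDr -scalemxAr Ur idot_U. Qed.

Lemma U_oppK a x : U (- a) *m (U a *m x) = x.
Proof. by rewrite mulmxA -UD addNr U0 mul1mx. Qed.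

Lemma nsq_orb a : nsq (orb a) = 1.
Proof. by rewrite !nsqE Ur. Qed.

Lemma reach_phase p x a t : reach_evol p x -> reach_evol p.+1 (phase (orb a) t x).
Proof.
move=> [s sx]; exists (- a); rewrite phase_evol U_oppK.
(* The evolution that brings [orb a] to [m] absorbs the pending one, so a single step is counted. *)
have -> : U (- a) *m x = U (- a - s) *m (U s *m x) by rewrite mulmxA -UD subrK.
exact: reachS.
Qed.

Lemma reach_move p x y a (c : R[i]) : y = x + c *: orb a -> nsq y = nsq x ->
  reach_evol p x -> reach_evol p.+1 y.
Proof.
move=> -> yx px; have [t <-] := phase_surj (nsq_orb a) yx.
exact: reach_phase.
Qed.

(* [z] is the part of the target already laid out; the rest of the amplitude
   sits at the point [orb a] of the orbit, where a phase can act on it. *)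
Definition bank p z a := nsq z <= 1 /\
  exists c : R[i], nsq (z + c *: orb a) = 1 /\ reach_evol p (z + c *: orb a).

Lemma bank0 : bank 0 0 0.
Proof.
split; first by rewrite nsq0.
exists 1; rewrite U0 mul1mx scale1r add0r; split=> //.
by exists 0; rewrite U0 mul1mx; exact: reach0.
Qed.

(** The state vector is the same; [w] only moves from the amplitude [c] into [z], so no phase is
    spent. *)
Lemma bank_piece p z a (w : R[i]) : nsq (z + w *: orb a) <= 1 ->
  bank p z a -> bank p (z + w *: orb a) a.
Proof.
move=> zw [_ [c cP]]; split=> //; exists (c - w).
by rewrite scalerBl addrACA -addrA (addrC (w *: _)) !addrA subrK.
Qed.

Lemma bank_end p z a : nsq z = 1 -> bank p z a -> reach_evol p.+1 z.
Proof.
move=> z1 [_ [c [c1 cP]]]; apply: (@reach_move _ _ _ a (- c) _ _ cP).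
  by rewrite scaleNr addrK.
by rewrite z1 c1.
Qed.

(* Three phases: add [d] at [a], add [e] at [b], remove [d] from [a], all three
   intermediate vectors being unit vectors. *)
Lemma bank_hop p z a b :
  1 <= 4 * (rdot (orb a) (orb b) ^+ 2 + idot (orb a) (orb b) ^+ 2) ->
  bank p z a -> bank p.+3 z b.
Proof.
set k1 := rdot _ _; set k2 := idot _ _ => k4 [z1 [c [c1 cP]]].
have g0 : 0 <= 1 - nsq z by rewrite subr_ge0.
(* Together the three equations say that z + d m_a, z + e m_b and z + d m_a + e m_b are unit
   vectors. *)
have [d1 [d2 [e1 [e2 [dE eE deE]]]]] := hop_coefs (rdot (orb a) z) (idot (orb a) z)
  (rdot (orb b) z) (idot (orb b) z) g0 k4.
have aux (g r s k k' : R) : e1 ^+ 2 + e2 ^+ 2 + 2 * (e1 * r + e2 * s) = g ->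
    2 * ((d1 * e1 + d2 * e2) * k - (d1 * e2 - d2 * e1) * k') = - g ->
    1 + (e1 ^+ 2 + e2 ^+ 2) * 1 + 2 * (e1 * (r + (d1 * k - d2 * - k'))
      + e2 * (s + (d1 * - k' + d2 * k))) = 1.
  by clear=> H1 H2; lra.
pose d := (d1 +i* d2)%C; pose e := (e1 +i* e2)%C.
have nd : nsq (z + d *: orb a) = 1.
  by rewrite nsqDZ nsq_orb mulr1 -addrA dE addrC subrK.
have ne : nsq (z + e *: orb b) = 1.
  by rewrite nsqDZ nsq_orb mulr1 -addrA eE addrC subrK.
have nde : nsq (z + d *: orb a + e *: orb b) = 1.
  rewrite nsqDZ nd nsq_orb rdotDr idotDr rdotZr idotZr (rdotC _ (orb a)).
  rewrite (idotC _ (orb a)) -/k1 -/k2; exact: aux eE deE.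
split; first exact: z1.
exists e; split; first exact: ne.
pose x1 := z + d *: orb a; pose x2 := x1 + e *: orb b.
have zde : z + e *: orb b = x2 + (- d) *: orb a.
  by rewrite scaleNr /x2 /x1 addrAC addrK.
have zdc := esym (addr_swap z (c *: orb a) (d *: orb a)).
rewrite -scalerBl -/x1 in zdc.
have r1 : reach_evol p.+1 x1 by apply: (reach_move zdc) cP; exact: etrans nd (esym c1).
have r2 : reach_evol p.+2 x2.
  by apply: (reach_move (erefl x2)) r1; exact: etrans nde (esym nd).
by apply: (reach_move zde) r2; exact: etrans ne (esym nde).
Qed.

(** * Hops between nearby points and transport around a period *)

Context (d : R) (d0 : 0 <= d) (Ud : forall t,
  nsq (orb t - (cos (t * d) -i* sin (t * d))%C *: m) <= t ^+ 2 * d).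

(** By [Ud], [orb (b - a)] is at distance at most 1 from a unit multiple of [m]; two such unit
    vectors overlap with modulus at least 1 / 2, as a hop demands. *)
Lemma bank_hop_near p z a b : (b - a) ^+ 2 * d <= 1 -> bank p z a -> bank p.+3 z b.
Proof.
move=> ab; apply: bank_hop.
have -> : orb b = U a *m orb (b - a) by rewrite mulmxA -UD addrC subrK.
rewrite Ur idot_U; set h := b - a in ab *; set k1 := rdot _ _; set k2 := idot _ _.
have := le_trans (Ud h) ab.
set C := cos _; set S := sin _.
have CS : C ^+ 2 + S ^+ 2 = 1 by exact: cos2Dsin2.
have -> : - ((C -i* S)%C *: m) = ((- C) +i* S)%C *: m.
  rewrite -scaleNr; congr (_ *: _).
  by apply/eqP; rewrite eq_complex /= opprK !eqxx.
rewrite nsqDZ nsq_orb m1 -/k1 -/k2 => H.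
have : 1 <= 2 * (C * k1 - S * k2) by nra.
have : 0 <= (C * k2 + S * k1) ^+ 2 by exact: sqr_ge0.
have -> : k1 ^+ 2 + k2 ^+ 2 = (C * k1 - S * k2) ^+ 2 + (C * k2 + S * k1) ^+ 2.
  by rewrite -[LHS]mul1r -CS; ring.
nra.
Qed.

Lemma bank_hops k p z a h : h ^+ 2 * d <= 1 -> bank p z a ->
  bank (p + 3 * k) z (a + h *+ k).
Proof.
move=> hd pz; elim: k => [|k IHk]; first by rewrite muln0 addn0 addr0.
rewrite mulnS addnCA mulrS addrCA; apply: bank_hop_near IHk.
by rewrite addrK.
Qed.

Context (Up : U (pi *+ 2) = 1%:M).

Lemma U_period (j : int) t : U (t + (pi *+ 2) *~ j) = U t.
Proof.
have Un (k : nat) s : U (s + (pi *+ 2) *+ k) = U s.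
  by elim: k => [|k IHk]; rewrite ?addr0// mulrS addrCA UD Up mul1mx.
case: j => k; first exact: Un.
by rewrite NegzE mulrNz -(Un k.+1 (t - _)) subrK.
Qed.

(** Modulo the period, [b] lies at most 2 pi after [a]; K equal hops cover this, each short enough
    because 2 pi sqrt d <= K. *)
Lemma bank_transport K p z a b : (pi *+ 2) ^+ 2 * d <= K%:R ^+ 2 -> (0 < K)%N ->
  bank p z a -> bank (p + 3 * K) z b.
Proof.
move=> Kd K0 pz.
pose P : R := pi *+ 2.
have P0 : 0 < P by rewrite pmulrn_lgt0// pi_gt0.
pose j := Num.floor ((b - a) / P); pose t := b - a - P *~ j.
have /andP[t0 tP] : 0 <= t <= P.
  have := real_floor_itv (num_real ((b - a) / P)).
  rewrite -/j ler_pdivlMr// ltr_pdivrMr// intrD mulrDl mul1r /t -mulrzl => /andP[j1 j2].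
  by apply/andP; split; lra.
have tK : a + (t / K%:R) *+ K = a + t.
  by rewrite -[_ *+ K]mulr_natr divfK// pnatr_eq0 -lt0n.
have U_eq : U (a + (t / K%:R) *+ K) = U b.
  rewrite tK -(U_period j (a + t)); congr U.
  by rewrite /t -/P addrCA addrA subrK subrK.
have : bank (p + 3 * K) z (a + (t / K%:R) *+ K).
  apply: bank_hops pz.
  rewrite expr_div_n mulrAC ler_pdivrMr ?exprn_gt0 ?ltr0n// mul1r.
  apply: le_trans Kd; apply: ler_wpM2r => //.
  by rewrite ler_pXn2r// nnegrE// ltW.
by rewrite /bank U_eq.
Qed.

(** * Laying out the uniform state: pairs, stops and rounds *)

Context (s : 'cV[R[i]]_n) (nu eps h : R) (T : seq R).
Context (s1 : nsq s = 1) (Us : forall t, U t *m s = s) (ms : rdot m s = nu).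
Context (hd : h ^+ 2 * d <= 1) (eps0 : 0 <= eps).
Context (qeps : nsq (m + orb (h *+ 4)) <= eps ^+ 2).
Context (Ts : \sum_(t <- T) orb t = ((size T)%:R * nu)%:C%C *: s).

Local Notation q t := (orb t + orb (t + h *+ 4)).

Lemma rdot_s_orb t : rdot s (orb t) = nu.
Proof. by rewrite -{1}(Us t) Ur rdotC. Qed.

Lemma pair_orb t : q t = U t *m (m + orb (h *+ 4)).
Proof. by rewrite mulmxDr mulmxA -UD. Qed.

(* The two points of a pair nearly cancel, while their overlaps with [s] add up:
   a combination [r] of pairs of total weight [B] is short but has overlap
   [2 nu B] with [s]. *)
Definition pairs_of (B : R) (r : 'cV[R[i]]_n) :=
  [/\ 0 <= B, nsq r <= (eps * B) ^+ 2 & rdot s r = 2 * nu * B].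

Lemma pairs_of0 : pairs_of 0 0.
Proof. by split; rewrite ?nsq0 ?rdot0r ?mulr0// expr0n. Qed.

Lemma pairs_ofD B r b t : 0 <= b -> pairs_of B r -> pairs_of (B + b) (r + b%:C%C *: q t).
Proof.
move=> b0 [B0 rB sr]; split; first exact: addr_ge0.
  rewrite mulrDr; apply: nsqD_le rB _; rewrite ?mulr_ge0//.
  by rewrite nsq_scaler pair_orb nsqE Ur -nsqE exprMn mulrC ler_wpM2r// sqr_ge0.
by rewrite rdotDr rdot_scaler rdotDr !rdot_s_orb sr; ring.
Qed.

(** The subtracted vector has norm at most eps B + w and overlap 2 nu B + nu w with [s]; the square
    is expanded. *)
Lemma nsq_target y B r w t : pairs_of B r -> 0 <= w ->
  nsq (y%:C%C *: s - r - w%:C%C *: orb t) <=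
  y ^+ 2 - 2 * y * (2 * nu * B + nu * w) + (eps * B + w) ^+ 2.
Proof.
move=> [B0 rB sr] w0.
have -> : y%:C%C *: s - r - w%:C%C *: orb t =
    y%:C%C *: s + (- 1)%:C%C *: (r + w%:C%C *: orb t).
  by rewrite rmorphN1 scaleN1r opprD addrA.
rewrite nsqD !nsq_scaler s1 mulr1 sqrrN expr1n mul1r rdot_scaler.
rewrite [rdot (_ *: s) _]rdotC rdot_scaler rdotC rdotDr rdot_scaler rdot_s_orb sr.
have : nsq (r + w%:C%C *: orb t) <= (eps * B + w) ^+ 2.
  by apply: nsqD_le rB _; rewrite ?mulr_ge0// nsq_scaler nsq_orb mulr1.
move: (nsq (r + _)) => X XB; lra.
Qed.

Lemma take_piece (V : lmodType R[i]) (x r u v : V) (b w : R[i]) :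
  x - (r + (b + w) *: (u + v)) + w *: u = x - (r + b *: (u + v)) - w *: v.
Proof. by rewrite scalerDl (scalerDr w) !opprD !addrA addrAC subrK. Qed.

(* A pair of weight [a (1 + ... + i)] is laid out in pieces [a j], for [j] from [i]
   down to [1], so that each piece is small compared with what remains. *)
Lemma bank_pairs J a Bmax y t :
  0 <= a ->
  (forall B i, (i <= J)%N -> a * (i%:R * (i%:R - 1)) / 2 <= B -> 0 <= B -> B <= Bmax ->
     y ^+ 2 - 2 * y * (2 * nu * B + nu * (a * i%:R)) + (eps * B + a * i%:R) ^+ 2 <= 1) ->
  forall i p B r, (i <= J)%N -> pairs_of B r ->
  B + a * (i%:R * (i%:R + 1)) / 2 <= Bmax ->
  bank p (y%:C%C *: s - (r + (a * (i%:R * (i%:R + 1)) / 2)%:C%C *: q t)) t ->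
  bank (p + 24 * i) (y%:C%C *: s - r) t.
Proof.
move=> a0 safe; elim=> [|i IHi] p B r iJ Br BB.
  by rewrite muln0 addn0 mul0r mulr0 mul0r scale0r addr0.
set b := a * (i%:R * (i%:R + 1)) / 2.
have b0 : 0 <= b by rewrite /b !mulr_ge0 ?invr_ge0 ?addr_ge0.
pose B' := B + b; pose r' := r + b%:C%C *: q t; pose w := a * i.+1%:R.
have w0 : 0 <= w by rewrite mulr_ge0.
have Br' : pairs_of B' r' by exact: pairs_ofD.
(* Triangular numbers: the pair splits into the current piece [w] and the weight [b] of the smaller
   pieces to follow. *)
have bE : a * (i.+1%:R * (i.+1%:R + 1)) / 2 = b + w.
  by rewrite /b /w -natr1; field.
have B'0 : 0 <= B' by case: Br'.
have B'm : B' <= Bmax by move: BB; rewrite bE /B'; lra.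
have bB' : b <= B' by rewrite lerDr; case: Br.
have safe0 : y ^+ 2 - 2 * y * (2 * nu * B' + nu * 0) + (eps * B' + 0) ^+ 2 <= 1.
  by have := safe B' 0%N isT; rewrite !mul0r !mulr0 mul0r => ->.
have safew : y ^+ 2 - 2 * y * (2 * nu * B' + nu * w) + (eps * B' + w) ^+ 2 <= 1.
  apply: safe => //; move: bB'; rewrite /b -[i.+1%:R]natr1 addrK.
  by rewrite [i%:R * _]mulrC.
(* Four hops of length [h], at three phases each, join the two points of a pair; going and returning
   cost the 24 phases of one piece. *)
have hopK (u v : 'cV[R[i]]_n) k t1 t2 : t2 = t1 + h *+ 4 \/ t2 = t1 - h *+ 4 ->
    bank k u t1 -> bank (k + 12) u t2.
  case=> -> ku; first exact: (@bank_hops 4).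
  by rewrite -mulNrn; apply: (@bank_hops 4) => //; rewrite sqrrN.
rewrite bE rmorphD => P0.
(* A piece is put at [t], another at [t + h *+ 4], then the amplitude returns. In between, one
   unpaired vector of weight [w] is missing; [safew] covers this. *)
have P1 : bank p (y%:C%C *: s - r' - w%:C%C *: orb (t + h *+ 4)) t.
  rewrite /r' -take_piece; apply: bank_piece P0.
  by rewrite take_piece; apply: le_trans (nsq_target _ _ _ _) safew.
have P2 := hopK _ 0 _ _ _ (or_introl (erefl _)) P1.
have P3 : bank (p + 12) (y%:C%C *: s - r') (t + h *+ 4).
  rewrite -[y%:C%C *: s - r'](subrK (w%:C%C *: orb (t + h *+ 4))).
  apply: bank_piece P2; rewrite subrK.
  have := nsq_target y 0 Br' (lexx 0); rewrite scale0r subr0 => le1.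
  exact: le_trans le1 safe0.
have P4 : bank (p + 12 + 12) (y%:C%C *: s - r') t.
  by apply: hopK 0 _ _ _ _ P3; right; rewrite addrK.
have -> : (p + 24 * i.+1 = p + 12 + 12 + 24 * i)%N by rewrite mulnS -!addnA.
apply: IHi (ltnW iJ) Br _ P4; apply: le_trans BB; rewrite bE -/b; lra.
Qed.

(** By [Ts] and the invariance of [s], pairs of equal weight W at all the times in [T] add up to 2
    |T| nu W times [s], which raises the coefficient from y' to y. *)
Lemma bank_round K J a y y' t p :
  (pi *+ 2) ^+ 2 * d <= K%:R ^+ 2 -> (0 < K)%N -> 0 <= a ->
  let W := a * (J%:R * (J%:R + 1)) / 2 in
  (forall B i, (i <= J)%N -> a * (i%:R * (i%:R - 1)) / 2 <= B -> 0 <= B ->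
     B <= (size T)%:R * W ->
     y ^+ 2 - 2 * y * (2 * nu * B + nu * (a * i%:R)) + (eps * B + a * i%:R) ^+ 2 <= 1) ->
  y = y' + 2 * (size T)%:R * nu * W ->
  bank p (y'%:C%C *: s) t ->
  exists t', bank (p + size T * (3 * K + 24 * J)) (y%:C%C *: s) t'.
Proof.
move=> Kd K0 a0 W safe yE P0.
have W0 : 0 <= W by rewrite /W !mulr_ge0 ?invr_ge0 ?addr_ge0.
have qT : \sum_(t' <- T) W%:C%C *: q t' = (2 * (size T)%:R * nu * W)%:C%C *: s.
  rewrite -scaler_sumr big_split /=.
  have -> : \sum_(t' <- T) orb (t' + h *+ 4) = U (h *+ 4) *m \sum_(t' <- T) orb t'.
    by rewrite mulmx_sumr; apply: eq_bigr => t' _; rewrite mulmxA -UD addrC.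
  rewrite Ts -scalemxAr Us -scalerDl scalerA -rmorphD -rmorphM.
  by congr (_%:C%C *: _); ring.
(* The part laid out is written as the goal minus the pairs still to come, so the induction is on
   the stops [T'] not yet visited. *)
suff gen T' : (size T' <= size T)%N -> forall p' t', 
    bank p' (y%:C%C *: s - \sum_(t <- T') W%:C%C *: q t) t' ->
    exists t', bank (p' + size T' * (3 * K + 24 * J)) (y%:C%C *: s) t'.
  by apply: (gen T (leqnn _) _ t); rewrite qT -scalerBl -rmorphB yE addrK.
have ok T1 : pairs_of ((size T1)%:R * W) (\sum_(t <- T1) W%:C%C *: q t).
  elim: T1 => [|u T1 IH]; first by rewrite big_nil mul0r; exact: pairs_of0.
  by rewrite big_cons addrC /= -natr1 mulrDl mul1r; exact: pairs_ofD.
elim: T' => [|u T' IH] sT p' t' P1.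
  by exists t'; rewrite mul0n addn0; move: P1; rewrite big_nil subr0.
have := bank_transport u Kd K0 P1; rewrite big_cons (addrC (W%:C%C *: q u)) => P2.
have le1 : (size T')%:R * W + W <= (size T)%:R * W.
  by rewrite -[X in _ + X]mul1r -mulrDl natr1 ler_wpM2r ?ler_nat.
have P3 := bank_pairs a0 safe (leqnn J) (ok T') le1 P2.
have [t2 P4] := IH (ltnW sT) _ _ P3.
by exists t2; move: P4; rewrite /= mulSn !addnA.
Qed.

(** After k rounds the coefficient of [s] is 1 - ((L - k) / L) ^ 2: the increments shrink linearly,
    and with them the excursions of a round, which thus stay in the unit ball. The extra phase in
    the count clears the leftover amplitude at the end. *)
Lemma reach_target K J L :
  (pi *+ 2) ^+ 2 * d <= K%:R ^+ 2 -> (0 < K)%N -> (0 < J)%N -> (0 < L)%N ->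
  0 < nu -> (0 < size T)%N ->
  3 * (eps / (2 * nu) + 1 / (nu * (size T)%:R * (J%:R + 1))) <= L%:R ->
  2 <= nu ^+ 2 * L%:R ^+ 2 * J%:R * (J%:R + 1) ->
  reach (L * (size T * (3 * K + 24 * J))).+1 s.
Proof.
move=> Kd K0 J0 L0 nu0 M0 H1 H2.
have LR : 0 < L%:R :> R by rewrite ltr0n.
have JR : 0 < J%:R :> R by rewrite ltr0n.
have MR : 0 < (size T)%:R :> R by rewrite ltr0n.
have LN : L%:R != 0 :> R by rewrite gt_eqF.
pose f k : R := 1 - ((L - k)%:R / L%:R) ^+ 2.
suff [t Pt] : exists t, bank (L * (size T * (3 * K + 24 * J))) ((f L)%:C%C *: s) t.
  have f1 : (f L)%:C%C *: s = s.
    by rewrite /f subnn mul0r expr0n subr0 scale1r.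
  rewrite f1 in Pt; have [t1] := bank_end s1 Pt.
  by rewrite Us.
suff gen k : (k <= L)%N ->
    exists t, bank (k * (size T * (3 * K + 24 * J))) ((f k)%:C%C *: s) t.
  exact: gen.
elim: k => [|k IHk] kL.
  exists 0; rewrite /f subn0 divff// expr1n subrr scale0r mul0n; exact: bank0.
have [t Pt] := IHk (ltnW kL).
pose l := (L - k.+1)%N.
have lE : (L - k)%:R = l%:R + 1 :> R by rewrite natr1 /l -subSn.
pose de : R := (2 * l%:R + 1) / L%:R ^+ 2.
(* Chosen so that |T| pairs of weight a J (J + 1) / 2 add exactly [de] to the coefficient of [s]. *)
pose a : R := de / (nu * (size T)%:R * J%:R * (J%:R + 1)).
have J1 : J%:R + 1 != 0 :> R by rewrite gt_eqF// addr_gt0.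
have a0 : 0 <= a.
  by rewrite !(mulr_ge0, invr_ge0, exprn_ge0, addr_ge0) ?ler0n// ltW.
rewrite mulSn addnC.
apply: (bank_round Kd K0 a0 _ _ Pt) => [B i iJ h1 B0 B1|].
  apply: (@safe_coefs _ eps nu a L%:R (size T) J l i B) => //.
  - by rewrite ltr_nat /l ltn_subrL.
  - apply: (le_trans B1); rewrite le_eqVlt; apply/orP; left; apply/eqP.
    by rewrite /a /de; field; rewrite !gt_eqF//= addr_gt0.
rewrite /f -/l lE /a /de.
by field; rewrite !gt_eqF//= addr_gt0.
Qed.

End Walk.

(** * Exponentials of diagonalizable matrices *)

Definition cis (R : realType) (y : R) : R[i] := (cos y -i* sin y)%C.

Lemma exp_coeff_cis (R : realType) (y : R) k :
  (k`!%:R)^-1 * (- 'i%C * y%:C%C) ^+ k = (cos_coeff y k -i* sin_coeff y k)%C.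
Proof.
have even_pow l : (- 'i%C : R[i]) ^+ l.*2 = ((-1) ^+ l)%:C%C.
  by rewrite -muln2 mulnC exprM sqrrN sqr_i rmorphXn rmorphN1.
have fE : (k`!%:R)^-1 = ((k`!%:R : R)^-1)%:C%C :> R[i] by rewrite fmorphV rmorph_nat.
(* [sin_coeff] uses [k.-1./2], which agrees with [k./2] for odd k. *)
have k1 : odd k -> k.-1./2 = k./2.
  by move=> ok; rewrite -[in LHS](odd_double_half k) ok /= doubleK.
rewrite exprMn -rmorphXn fE /cos_coeff /sin_coeff /= -exprnP.
rewrite -[X in (- 'i%C) ^+ X]odd_double_half.
case: (odd k) k1 => [/(_ isT) ->|_]; rewrite exprD even_pow ?expr0 ?expr1;
  apply/eqP; rewrite eq_complex !Re_mul !Im_mul /=;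
  move: (_ ^-1) (y ^+ k) ((-1) ^+ _) => f yk z; apply/andP; split; apply/eqP; ring.
Qed.

Section Limits.
Local Open Scope classical_set_scope.

Lemma cvg_complex (R : realType) (u v : nat -> R) (a b : R) :
  u @ \oo --> a -> v @ \oo --> b ->
  (fun k => (u k -i* v k)%C : (R[i])^o) @ \oo --> ((a -i* b)%C : (R[i])^o).
Proof.
move=> /cvgrPdist_lt ua /cvgrPdist_lt vb; apply/cvgrPdist_lt => -[e e'].
rewrite ltcE /= => /andP[/eqP -> e0].
near=> k.
have ak : `|a - u k| < e / 2 by near: k; apply: ua; rewrite divr_gt0.
have bk : `|b - v k| < e / 2 by near: k; apply: vb; rewrite divr_gt0.
have -> : (a -i* b)%C - (u k -i* v k)%C = (a - u k)%:C%C - 'i%C * (b - v k)%:C%C.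
  by apply/eqP; rewrite eq_complex /=; apply/andP; split; apply/eqP; ring.
apply: le_lt_trans (ler_normB _ _) _.
rewrite normrM !normc_def /= !expr0n /= !addr0 add0r expr1n sqrtr1 mul1r !sqrtr_sqr.
rewrite -rmorphD ltcR; lra.
Unshelve. all: by end_near. Qed.

Lemma cvg_exp_cis (R : realType) (y : R) :
  (fun N => \sum_(k < N) (k`!%:R)^-1 * (- 'i%C * y%:C%C) ^+ k : (R[i])^o) @ \oo
    --> (cis y : (R[i])^o).
Proof.
have -> : (fun N => \sum_(k < N) (k`!%:R)^-1 * (- 'i%C * y%:C%C) ^+ k : (R[i])^o) =
    (fun N => (series (cos_coeff y) N -i* series (sin_coeff y) N)%C).
  apply/funext => N; under eq_bigr do rewrite exp_coeff_cis.
  rewrite /series /= !big_mkord.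
  elim/big_ind3 : _ => //= [|x1 x2 x3 y1 y2 y3 -> ->].
    by rewrite oppr0.
  by apply/eqP; rewrite eq_complex /= opprD !eqxx.
apply: cvg_complex; rewrite /cis.
  by rewrite unlock; exact: is_cvg_series_cos_coeff.
by rewrite unlock; exact: is_cvg_series_sin_coeff.
Qed.

End Limits.

Lemma cexp_cis (R : realType) (y : R) : cexp (- 'i%C * y%:C%C) = cis y.
Proof. exact: (@cvg_lim (R[i])^o (@norm_hausdorff _ _) _ _ _ _ _ (@cvg_exp_cis R y)). Qed.

Section Mexp.
Context (R : realType) (n : nat) (P Q : 'M[R[i]]_n).
Hypothesis PQ : P *m Q = 1%:M.

Lemma conj_diagM (f g : 'I_n -> R[i]) :
  (Q *m diag_mx (\row_j f j) *m P) *m (Q *m diag_mx (\row_j g j) *m P) =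
  Q *m diag_mx (\row_j (f j * g j)) *m P.
Proof.
rewrite !mulmxA -(mulmxA _ P Q) PQ mulmx1 -(mulmxA Q) mulmx_diag.
by congr (_ *m diag_mx _ *m _); apply/rowP => j; rewrite !mxE.
Qed.

Lemma conj_diagE (f : 'I_n -> R[i]) a b :
  (Q *m diag_mx (\row_j f j) *m P) a b = \sum_j Q a j * f j * P j b.
Proof. by rewrite mxE; apply: eq_bigr => j _; rewrite mul_mx_diag !mxE. Qed.

Hypothesis QP : Q *m P = 1%:M.

Lemma conj_diagX (f : 'I_n -> R[i]) k :
  (Q *m diag_mx (\row_j f j) *m P) ^+ k = Q *m diag_mx (\row_j (f j ^+ k)) *m P.
Proof.
elim: k => [|k IHk].
  have -> : \row_j (f j ^+ 0) = const_mx 1 by apply/rowP => j; rewrite !mxE expr0.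
  by rewrite diag_const_mx mulmx1 QP.
rewrite exprS IHk -[_ * _]/(_ *m _) conj_diagM.
by congr (_ *m diag_mx _ *m _); apply/rowP => j; rewrite !mxE exprS.
Qed.

(** Powers pass to the diagonal, so each entry of a partial sum is a finite combination of scalar
    exponential series. *)
Lemma mexp_conj_diag (x : 'I_n -> R) :
  mexp (Q *m diag_mx (\row_j (- 'i%C * (x j)%:C%C)) *m P) =
  Q *m diag_mx (\row_j cis (x j)) *m P.
Proof.
apply/matrixP => a b; rewrite conj_diagE mxE.
pose u j N : R[i] := \sum_(k < N) (k`!%:R)^-1 * (- 'i%C * (x j)%:C%C) ^+ k.
have -> : (fun N => (\sum_(k < N) (k`!%:R)^-1 *:
     (Q *m diag_mx (\row_j (- 'i%C * (x j)%:C%C)) *m P) ^+ k) a b : (R[i])^o) =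
   (fun N => \sum_j Q a j * u j N * P j b).
  apply/funext => N; rewrite summxE.
  under eq_bigr => k _ do rewrite mxE conj_diagX conj_diagE mulr_sumr.
  rewrite exchange_big; apply: eq_bigr => j _ /=.
  by rewrite /u mulr_sumr mulr_suml; apply: eq_bigr => k _; ring.
apply: (@cvg_lim (R[i])^o (@norm_hausdorff _ _)).
apply: (@cvg_big (R[i])^o _ +%R 0 xpredT) => [|j _]; first exact: add_continuous.
by apply: cvgMr_tmp; apply: cvgMl_tmp; exact: cvg_exp_cis.
Qed.

End Mexp.

Lemma sin_sqr_le (R : realType) (y : R) : sin y ^+ 2 <= y ^+ 2.
Proof.
wlog y0 : y / 0 <= y.
  move=> H; have [|/ltW y0] := lerP 0 y; first exact: H.
  by rewrite -sqrrN -sinN -[leRHS]sqrrN H// oppr_ge0.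
have [|c _] := @MVT_segment R sin cos 0 y y0 (fun x _ => is_derive_sin x).
  exact/continuous_subspaceT/continuous_sin.
by rewrite sin0 !subr0 => ->; rewrite exprMn -[leRHS]mul1r ler_wpM2r ?sqr_ge0//.
Qed.

Lemma cos_ge (R : realType) (y : R) : 2 * (1 - cos y) <= y ^+ 2.
Proof.
have {1}-> : y = (y / 2) *+ 2 by rewrite -mulr_natr divfK.
rewrite cos_mulr2n; have := sin_sqr_le (y / 2); have := cos2Dsin2 (y / 2).
rewrite exprMn exprVn; move: (cos _) (sin _) => C S; lra.
Qed.

Lemma cis0 (R : realType) : cis 0 = 1 :> R[i].
Proof. by rewrite /cis cos0 sin0 oppr0. Qed.

Lemma cisD (R : realType) (a b : R) : cis (a + b) = cis a * cis b.
Proof.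
rewrite /cis cosD sinD; apply/eqP; rewrite eq_complex Re_mul Im_mul /=.
by apply/andP; split; apply/eqP; ring.
Qed.

Lemma cispi (R : realType) : cis pi = -1 :> R[i].
Proof. by rewrite /cis cospi sinpi; apply/eqP; rewrite eq_complex /= oppr0 !eqxx. Qed.

Lemma cis_mulrz (R : realType) (a : R) (k : int) : cis (a * k%:~R) = cis a ^ k.
Proof.
have cisM (b : R) l : cis (b * l%:R) = cis b ^+ l.
  elim: l => [|l IHl]; first by rewrite mulr0 cis0.
  by rewrite -natr1 mulrDr mulr1 cisD IHl exprSr.
case: k => k; first exact: cisM.
have aN : cis (- a) * cis a = 1 by rewrite -cisD addNr cis0.
rewrite NegzE rmorphN mulrN -mulNr cisM -exprnN -exprVn; congr (_ ^+ _).
have a0 : cis a != 0 by apply: contra_eq_neq aN => ->; rewrite mulr0 eq_sym oner_eq0.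
by apply: (mulIf a0); rewrite aN mulVf.
Qed.

Lemma cis_conj (R : realType) (a : R) : ((cis a)^*%C : R[i]) * cis a = 1.
Proof.
rewrite /cis /=; apply/eqP; rewrite eq_complex !Re_mul !Im_mul /= -(cos2Dsin2 a).
by apply/andP; split; apply/eqP; ring.
Qed.

(** The squared chord is 2 (1 - cos (a - b)), at most the squared arc. *)
Lemma norm_cisB (R : realType) (a b : R) :
  complex.Re (cis a - cis b) ^+ 2 + complex.Im (cis a - cis b) ^+ 2 <= (a - b) ^+ 2.
Proof.
apply: le_trans (cos_ge _); rewrite /cis /= cosB.
by have := cos2Dsin2 a; have := cos2Dsin2 b;
   move: (cos a) (sin a) (cos b) (sin b) => *; lra.
Qed.

(** The projector is already diagonal in the vertex basis, so the diagonalizing matrices are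
    identities and [y] is t at [m], 0 elsewhere. *)
Lemma mexp_proj1 (R : realType) n (m : 'I_n) (t : R) (x : 'cV_n) :
  mexp (- 'i%C * t%:C%C *: proj1 R m) *m x = phase (ket R m) t x.
Proof.
pose y j : R := t * (j == m)%:R.
have -> : - 'i%C * t%:C%C *: proj1 R m =
    1%:M *m diag_mx (\row_j (- 'i%C * (y j)%:C%C)) *m 1%:M.
  rewrite mul1mx mulmx1; apply/matrixP => a b; rewrite !mxE /y.
  have [->|ab] := eqVneq a b; last first.
    rewrite mulr0n; case: andP => [[/eqP am /eqP bm]|_]; last by rewrite mulr0.
    by rewrite am bm eqxx in ab.
  by rewrite andbb mulr1n rmorphM rmorph_nat mulrA.
rewrite mexp_conj_diag ?mulmx1// mul1mx phaseE.
apply/matrixP => a b; rewrite ord1 mul_diag_mx !mxE /y.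
rewrite rdot_ket idot_ket eqxx andbT.
have [->|am] := eqVneq a m; last by rewrite !mulr0 cis0 mul1r addr0.
rewrite !mulr1; case: (x m 0) => x1 x2; apply/eqP.
rewrite /cis eq_complex !Re_add !Im_add !Re_mul !Im_mul /=.
by apply/andP; split; apply/eqP; ring.
Qed.

(** * Laplacian and its evolution *)

Section Laplacian.
Context (R : realType) (n : nat) (e : rel 'I_n).
Context (e_sym : symmetric e) (eirr : irreflexive e).

Lemma laplacianCE a b : laplacianC R e a b =
  (a == b)%:R * (degree e a)%:R - (e a b)%:R.
Proof. by rewrite !mxE rmorphB rmorphM !rmorph_nat. Qed.

Lemma laplacianC_sym : (laplacianC R e)^T = laplacianC R e.
Proof.
apply/matrixP => a b; rewrite mxE !laplacianCE e_sym eq_sym.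
by have [->|] := eqVneq a b; rewrite ?mul0r.
Qed.

(** The matrix is real symmetric, hence unitarily diagonalizable. Each row of [P] is a left
    eigenvector, so its diagonal entry is a root of the characteristic polynomial. *)
Lemma laplacian_spectral (s : seq int) :
  char_poly (laplacian e) = \prod_(x <- s) ('X - x%:P) ->
  exists (P : 'M[R[i]]_n) (x : 'I_n -> int),
  [/\ forall j, x j \in s, P *m (map_mx conjc P)^T = 1%:M
    & laplacianC R e = (map_mx conjc P)^T *m diag_mx (\row_j (x j)%:~R) *m P].
Proof.
move=> sE; set A := laplacianC R e.
have Anormal : A \is normalmx.
  apply: symmetric_normalmx.
    by apply/is_hermitianmxP; rewrite expr0 scale1r map_mx_id// laplacianC_sym.
  by apply/mxOverP => a b; rewrite laplacianCE rpredB ?rpredM ?rpred_nat.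
have := orthomx_spectralP Anormal; set P := spectralmx A; set sp := spectral_diag A => AE.
have Pu : P \is unitarymx := spectral_unitarymx A.
have Pi : invmx P = (map_mx conjc P)^T by rewrite invmx_unitary// map_trmx.
have PP : P *m invmx P = 1%:M by rewrite mulmxV// unitarymx_unit.
have root_s j : exists x, x \in s /\ sp 0 j = x%:~R.
  have ev : eigenvalue A (sp 0 j).
    apply/eigenvalueP; exists (row j P).
      rewrite -row_mul AE !mulmxA PP mul1mx row_mul row_diag_mx -scalemxAl.
      by rewrite -rowE.
    apply/eqP => r0; have := congr1 (fun B => row j B) PP.
    rewrite row_mul r0 mul0mx row1 => /rowP/(_ j)/eqP.
    by rewrite !mxE !eqxx eq_sym oner_eq0.
  rewrite eigenvalue_root_char /A /laplacianC -map_char_poly sE rmorph_prod /= in ev.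
  have {}ev : root (\prod_(z <- [seq z%:~R | z <- s]) ('X - z%:P)) (sp 0 j).
    rewrite big_map; move: ev; congr (root _ _).
    by apply: eq_bigr => z _; rewrite rmorphB /= map_polyX map_polyC.
  by move: ev; rewrite root_prod_XsubC => /mapP[z zs ->]; exists z.
have [x xP] := choice root_s.
exists P, x; split=> [j||]; first by case: (xP j).
  by rewrite -Pi.
rewrite -Pi {1}AE; congr (_ *m diag_mx _ *m _).
by apply/rowP => j; rewrite mxE; case: (xP j).
Qed.

End Laplacian.

Section Evolution.
Context (R : realType) (n : nat) (A P : 'M[R[i]]_n) (x : 'I_n -> int).
Local Notation Q := (map_mx conjc P)^T.
Context (PQ : P *m Q = 1%:M) (AE : A = Q *m diag_mx (\row_j (x j)%:~R) *m P).

Definition evol (t : R) : 'M[R[i]]_n := mexp (- 'i%C * t%:C%C *: A).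

Let QP : Q *m P = 1%:M. Proof. exact: mulmx1C. Qed.

Lemma evolE t : evol t = Q *m diag_mx (\row_j cis (t * (x j)%:~R)) *m P.
Proof.
rewrite /evol -(mexp_conj_diag PQ QP); congr mexp.
rewrite AE scalemxAl scalemxAr; congr (_ *m _ *m _).
by apply/matrixP => a b; rewrite !mxE mulrnAr rmorphM rmorph_int mulrA.
Qed.

Lemma evol0 : evol 0 = 1%:M.
Proof.
rewrite evolE; have -> : \row_j cis (0 * (x j)%:~R) = const_mx 1 :> 'rV[R[i]]_n.
  by apply/rowP => j; rewrite !mxE mul0r cis0.
by rewrite diag_const_mx mulmx1.
Qed.

Lemma evolD a b : evol (a + b) = evol a *m evol b.
Proof.
rewrite !evolE (conj_diagM PQ); congr (_ *m diag_mx _ *m _).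
by apply/rowP => j; rewrite !mxE mulrDl cisD.
Qed.

Lemma evol_period : evol (pi *+ 2) = 1%:M.
Proof.
rewrite -evol0 !evolE; congr (_ *m diag_mx _ *m _); apply/rowP => j.
rewrite !mxE mul0r cis0 cis_mulrz mulr2n cisD cispi mulrNN mulr1.
exact: exp1rz.
Qed.

Lemma dot_unitary (W : 'M[R[i]]_n) (u v : 'cV[R[i]]_n) :
  (map_mx conjc W)^T *m W = 1%:M ->
  rdot (W *m u) (W *m v) = rdot u v /\ idot (W *m u) (W *m v) = idot u v.
Proof.
move=> WW.
have : (rdot (W *m u) (W *m v) +i* idot (W *m u) (W *m v))%C =
       (rdot u v +i* idot u v)%C.
  by rewrite !dotE map_mxM trmx_mul -mulmxA (mulmxA _ W) WW mul1mx.
by case.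
Qed.

Lemma evol_dot t u v : rdot (evol t *m u) (evol t *m v) = rdot u v /\
  idot (evol t *m u) (evol t *m v) = idot u v.
Proof.
apply: dot_unitary; rewrite evolE.
have QE : (map_mx conjc Q)^T = P by apply/matrixP => a b; rewrite !mxE conjcK.
rewrite !map_mxM !trmx_mul QE map_diag_mx tr_diag_mx.
have -> : map_mx conjc (\row_j cis (t * (x j)%:~R)) =
    \row_j (conjc (cis (t * (x j)%:~R)) : R[i]).
  by apply/rowP => j; rewrite !mxE.
rewrite [_ *m (diag_mx _ *m P)]mulmxA (conj_diagM PQ).
have -> : \row_j (conjc (cis (t * (x j)%:~R)) * cis (t * (x j)%:~R)) =
    const_mx 1 :> 'rV[R[i]]_n.
  by apply/rowP => j; rewrite !mxE cis_conj.
by rewrite diag_const_mx mulmx1.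
Qed.

Lemma evol_fix t (v : 'cV[R[i]]_n) : A *m v = 0 -> evol t *m v = v.
Proof.
move=> Av; have Pv j : x j = 0 \/ (P *m v) j 0 = 0.
  have : diag_mx (\row_j (x j)%:~R) *m (P *m v) = 0.
    by rewrite -[LHS]mul1mx -PQ -!mulmxA (mulmxA Q) (mulmxA _ P) -AE Av mulmx0.
  move/matrixP => /(_ j 0); rewrite mul_diag_mx !mxE => /eqP.
  by rewrite mulf_eq0 intr_eq0 => /orP[] /eqP; [left|right].
rewrite evolE -!mulmxA; have -> : diag_mx (\row_j cis (t * (x j)%:~R)) *m (P *m v) = P *m v.
  apply/matrixP => j b; rewrite ord1 mul_diag_mx mxE mxE.
  by case: (Pv j) => ->; rewrite ?mulr0// cis0 mul1r.
by rewrite mulmxA QP mul1mx.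
Qed.

(** In the eigenbasis this is the chord bound [norm_cisB], coordinate by coordinate. *)
Lemma evol_lip t (c : R) (v : 'cV[R[i]]_n) :
  nsq (evol t *m v - cis (t * c) *: v) <= t ^+ 2 * nsq (A *m v - c%:C%C *: v).
Proof.
pose w := P *m v.
have nP u : nsq (P *m u) = nsq u by rewrite !nsqE; have [] := dot_unitary u u QP.
have E1 : P *m (evol t *m v - cis (t * c) *: v) =
    \col_j ((cis (t * (x j)%:~R) - cis (t * c)) * w j 0).
  rewrite mulmxBr -scalemxAr evolE !mulmxA PQ mul1mx -mulmxA -/w.
  by apply/matrixP => j b; rewrite ord1 mul_diag_mx !mxE mulrBl.
have E2 : P *m (A *m v - c%:C%C *: v) = \col_j (((x j)%:~R - c)%:C%C * w j 0).
  rewrite mulmxBr -scalemxAr AE !mulmxA PQ mul1mx -mulmxA -/w.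
  by apply/matrixP => j b; rewrite ord1 mul_diag_mx !mxE rmorphB rmorph_int mulrBl.
have F1 := etrans (esym (nP _)) (congr1 (@nsq R n) E1).
have F2 := etrans (esym (nP _)) (congr1 (@nsq R n) E2).
rewrite [leLHS]F1 [X in _ <= _ * X]F2 !nsq_sum mulr_sumr.
apply: ler_sum => j _; rewrite !(mxE _ _ j) !Re_mul !Im_mul /=.
have := norm_cisB (t * (x j)%:~R) (t * c); rewrite -mulrBr exprMn /cis /=.
move: (cos _ - cos _) (- sin _ - - sin _) (_ - c) (complex.Re _) (complex.Im _).
clear=> C S k a b CS.
have := ler_wpM2r (addr_ge0 (sqr_ge0 a) (sqr_ge0 b)) CS; lra.
Qed.

End Evolution.

(** * Halving the spectrum *)

Section Dyadic.
Local Open Scope nat_scope.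
Implicit Types (s : seq int) (x : int) (k : nat).

Lemma dvdn_foldr_gcd d (l : seq nat) : (d %| foldr gcdn 0 l) = all (dvdn d) l.
Proof. by elim: l => [|a l IHl] /=; rewrite ?dvdn0// dvdn_gcd IHl. Qed.

Lemma gcdS_gt0 s : 0 < gcdS s.
Proof. by rewrite /gcdS; case: eqP => // /eqP; rewrite lt0n. Qed.

Lemma gcdS_dvd s x : x \in s -> gcdS s %| `|x|%N.
Proof.
move=> xs; rewrite /gcdS; case: eqP => [_|_]; first exact: dvd1n.
have := dvdnn (foldr gcdn 0 [seq `|y|%N | y <- s]).
by rewrite dvdn_foldr_gcd => /allP; apply; apply: map_f.
Qed.

(** Otherwise twice the gcd would divide every element, hence the gcd itself, which is positive. *)
Lemma gcdS_odd s : ~~ only_zero s ->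
  exists2 x, x \in s & odd (`|x|%N %/ gcdS s).
Proof.
move=> /allPn[y ys y0]; apply/hasP; apply: contraNT y0 => /hasPn ev.
set g := foldr gcdn 0 [seq `|y|%N | y <- s].
have [g0|gN0] := eqVneq g 0.
  have := dvdn0 0; rewrite -{2}g0 dvdn_foldr_gcd => /allP /(_ _ (map_f _ ys)).
  by rewrite dvd0n absz_eq0.
have gE : gcdS s = g by rewrite /gcdS -/g (negPf gN0).
have : 2 * g %| g.
  rewrite {2}/g dvdn_foldr_gcd; apply/allP => _ /mapP[x xs ->].
  have := ev x xs; rewrite -dvdn2 -gE -{2}(divnK (gcdS_dvd xs)) => h.
  exact: dvdn_mul.
by move/dvdn_leq => /(_ _); rewrite lt0n => /(_ gN0); rewrite leqNgt ltn_Pmull// lt0n.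
Qed.

(** The search in [dL] succeeds: each step discards a nonzero element, and there are at most
    [\sum_(x <- s) |x|] of these. *)
Lemma only_zero_dL s : only_zero (Lam (dL s) s).
Proof.
pose c k := count (fun x => x != 0%R) (Lam k s).
have c0 : c 0 <= \sum_(x <- s) `|x|%N.
  rewrite /c /=; elim: s {c} => [|x s IHs] /=; first by rewrite big_nil.
  by rewrite big_cons leq_add// -absz_gt0; case: `|x|%N.
have cdec k : ~~ only_zero (Lam k s) -> c k.+1 < c k.
  move=> /gcdS_odd[x xs xo].
  have x0 : x != 0%R by apply: contraTneq xo => ->; rewrite div0n.
  pose ev (y : int) := ~~ odd (`|y|%N %/ gcdS (Lam k s)).
  pose F := [seq y <- Lam k s | y != 0%R].
  have -> : c k.+1 = count ev F.
    rewrite /F count_filter /c /Lam iterS count_filter.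
    by apply: eq_count => y /=; rewrite andbC.
  have -> : c k = size F by rewrite size_filter.
  rewrite -(count_predC ev F) -[ltnLHS]addn0 ltn_add2l -has_count.
  by apply/hasP; exists x; rewrite ?mem_filter ?x0//= negbK.
pose p k := only_zero (Lam k s); set N := \sum_(x <- s) _ in c0.
have hp : has p (iota 0 N.+1).
  apply/negP => /negP/hasPn np.
  suff gen k : k <= N.+1 -> c k + k <= N.
    by have := gen N.+1 (leqnn _); rewrite addnS ltnNge leq_addl.
  elim: k => [_|k IHk kN]; first by rewrite addn0.
  rewrite addnS -addSn; apply: leq_trans (IHk (ltnW kN)).
  by rewrite leq_add2r cdec// np// mem_iota.
have := nth_find 0 hp; rewrite nth_iota//.
by move: hp; rewrite has_find size_iota.
Qed.

(** A nonzero element does not survive to the last level; at the level where it is discarded its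
    quotient is odd. *)
Lemma dL_split s x : x \in s -> x != 0%R ->
  exists2 k, k < dL s & (gcdS (Lam k s) %| `|x|%N) && odd (`|x|%N %/ gcdS (Lam k s)).
Proof.
move=> xs x0.
have [/hasP[k]|/hasPn H] :=
  boolP (has (fun k => (x \in Lam k s) && odd (`|x|%N %/ gcdS (Lam k s))) (iota 0 (dL s))).
  by rewrite mem_iota /= add0n => kd /andP[xk ok]; exists k; rewrite ?ok ?gcdS_dvd.
suff : x \in Lam (dL s) s.
  by move/(allP (only_zero_dL s)) => /eqP x00; rewrite x00 in x0.
suff gen k : k <= dL s -> x \in Lam k s by exact: gen.
elim: k => [//|k IHk] kd; have xk := IHk (ltnW kd).
rewrite /Lam iterS -/(Lam k s) mem_filter xk andbT.
by have := H k; rewrite mem_iota /= add0n xk /=; apply.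
Qed.

End Dyadic.

(** * Subset sums of the dyadic times *)

Section Subsets.
Context (R : realType).
Implicit Types (tau : nat -> R) (k : nat).

(** Coinciding sums are kept with multiplicity, so that sums of exponentials factor into a
    product. *)
Fixpoint subset_sums tau k : seq R :=
  if k is k'.+1 then subset_sums tau k' ++ [seq t + tau k' | t <- subset_sums tau k']
  else [:: 0].

Lemma size_subset_sums tau k : size (subset_sums tau k) = (2 ^ k)%N.
Proof. by elim: k => //= k IHk; rewrite size_cat size_map IHk addnn expnS mul2n. Qed.

Lemma sum_cis_subset_sums tau k (y : R) :
  \sum_(t <- subset_sums tau k) cis (t * y) = \prod_(j < k) (1 + cis (tau j * y)).
Proof.
elim: k => [|k IHk] /=; first by rewrite big_ord0 big_seq1 mul0r cis0.
rewrite big_cat big_map /= big_ord_recr /= -IHk mulrDr mulr1; congr (_ + _).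
by rewrite mulr_suml; apply: eq_bigr => t _; rewrite mulrDl cisD.
Qed.

Definition dyadic_time (s : seq int) k : R := pi / (gcdS (Lam k s))%:R.

(** At the level where x / gcd is odd, the exponential is exp(- i pi (x / gcd)) = - 1 and its factor
    vanishes. *)
Lemma cis_dyadic_time s (x : int) : x \in s -> x != 0 ->
  \prod_(k < dL s) (1 + cis (dyadic_time s k * x%:~R)) = 0 :> R[i].
Proof.
move=> xs x0; have [k kd /andP[gx xo]] := dL_split xs x0.
rewrite (bigD1 (Ordinal kd)) //=; set g := gcdS _ in gx xo *.
suff -> : cis (dyadic_time s k * x%:~R) = -1 :> R[i] by rewrite subrr mul0r.
have [y xE] : exists y : int, x = y * g%:Z by apply/dvdzP.
have g0 : (0 < g)%N by exact: gcdS_gt0.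
have -> : dyadic_time s k * x%:~R = pi * y%:~R.
  by rewrite /dyadic_time -/g xE intrM; field; rewrite pnatr_eq0 -lt0n.
rewrite cis_mulrz cispi.
have : odd `|y|%N by move: xo; rewrite xE abszM absz_nat mulnK.
case: (y) => l; rewrite ?NegzE ?abszN absz_nat => ol.
  by rewrite -exprnP -signr_odd ol expr1.
by rewrite -exprnN -exprVn invrN1 -signr_odd ol expr1.
Qed.

End Subsets.

(** * The Laplacian at the marked vertex and its kernel *)

Section Graph.
Context (R : realType) (n : nat) (e : rel 'I_n).
Context (e_sym : symmetric e) (eirr : irreflexive e).
Local Notation A := (laplacianC R e).

Lemma degreeE a : (degree e a)%:R = \sum_b (e a b)%:R :> R.
Proof.
rewrite /degree -sum1_card natr_sum big_mkcond; apply: eq_bigr => b _.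
have -> : (b \in [set b | e a b]%classic) = e a b.
  by apply/idP/idP => [/set_mem|/mem_set].
by case: (e a b).
Qed.

Lemma laplacian_mul (v : 'cV[R[i]]_n) a :
  (A *m v) a 0 = \sum_b (e a b)%:R * (v a 0 - v b 0).
Proof.
rewrite mxE; under eq_bigr do rewrite laplacianCE mulrBl.
under [RHS]eq_bigr do rewrite mulrBr.
rewrite !sumrB; congr (_ - _).
rewrite (bigD1 a)//= big1 => [|b /negPf ab]; last by rewrite eq_sym ab !mul0r.
rewrite eqxx mul1r addr0 -mulr_suml; congr (_ * _).
rewrite -(rmorph_nat (real_complex R)) degreeE rmorph_sum.
by apply: eq_bigr => b _; rewrite rmorph_nat.
Qed.

Lemma laplacian_const (c : R[i]) : A *m (const_mx c : 'cV_n) = 0.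
Proof.
apply/matrixP => a b; rewrite ord1 laplacian_mul [RHS]mxE big1// => k _.
by rewrite !mxE subrr mulr0.
Qed.

(** The difference is minus the indicator vector of the neighbours of [m]. *)
Lemma laplacian_ket m :
  nsq (A *m ket R m - ((degree e m)%:R : R)%:C%C *: ket R m) = (degree e m)%:R.
Proof.
have -> : A *m ket R m - ((degree e m)%:R : R)%:C%C *: ket R m =
    \col_a (- ((e m a)%:R : R)%:C%C).
  apply/matrixP => a b; rewrite ord1 [LHS]mxE -colE [X in X + _]mxE laplacianCE !mxE.
  rewrite rmorph_nat eqxx andbT.
  have [->|] := eqVneq a m; rewrite ?eirr ?mul1r ?mul0r ?mulr1 ?mulr0.
    by rewrite subr0 subrr rmorph0 oppr0.
  by rewrite sub0r subr0 e_sym rmorph_nat.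
rewrite nsq_sum degreeE; apply: eq_bigr => a _.
by rewrite mxE /=; case: (e m a); rewrite /= ?oppr0 ?sqrrN ?expr1n ?expr0n ?addr0.
Qed.

(** The Dirichlet form, a sum of squares over edges, vanishes for the real and imaginary parts of
    [v]; so [v] agrees along edges, and connectedness concludes. *)
Lemma laplacian_ker (v : 'cV[R[i]]_n) : connected_graph e -> A *m v = 0 ->
  forall a b, v a 0 = v b 0.
Proof.
move=> conn Av.
have real_ker (r : 'I_n -> R) : (forall a, \sum_b (e a b)%:R * (r a - r b) = 0) ->
    forall a b, e a b -> r a = r b.
  move=> rz.
  have : \sum_a \sum_b (e a b)%:R * (r a - r b) ^+ 2 = 0.
    transitivity (2 * \sum_a r a * \sum_b (e a b)%:R * (r a - r b)); last first.
      by rewrite big1 ?mulr0// => a _; rewrite rz mulr0.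
    rewrite mulr_natl mulr2n.
    have -> : \sum_a r a * (\sum_b (e a b)%:R * (r a - r b)) =
              \sum_a \sum_b (e a b)%:R * (r a * (r a - r b)).
      by apply: eq_bigr => a _; rewrite mulr_sumr; apply: eq_bigr => b _; ring.
    rewrite [X in _ = _ + X]exchange_big /= -big_split; apply: eq_bigr => a _.
    by rewrite -big_split; apply: eq_bigr => b _ /=; rewrite e_sym; ring.
  move/eqP; rewrite psumr_eq0 => [/allP H|a _]; last first.
    by apply: sumr_ge0 => b _; rewrite mulr_ge0// sqr_ge0.
  move=> a b ab; have := H a (mem_index_enum a).
  rewrite psumr_eq0 => [/allP/(_ b (mem_index_enum b))|c _]; last first.
    by rewrite mulr_ge0// sqr_ge0.
  by rewrite ab mul1r sqrf_eq0 subr_eq0 => /eqP.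
have vE a b : e a b -> v a 0 = v b 0.
  have part (f : R[i] -> R) : {morph f : x y / x + y} -> f 0 = 0 ->
      (forall x, f (- x) = - f x) ->
      forall a b, e a b -> f (v a 0) = f (v b 0).
    move=> fD f0 fN; apply: real_ker => c.
    have := congr1 f (laplacian_mul v c).
    rewrite Av mxE f0 (big_morph f fD f0) => h; rewrite [RHS]h.
    apply: eq_bigr => k _; case: (e c k); last by rewrite !mul0r f0.
    by rewrite !mul1r fD fN.
  move=> ab; apply/eqP; rewrite eq_complex; apply/andP; split; apply/eqP.
    by apply: (part (@complex.Re R)) => //; [exact: Re_add|case].
  by apply: (part (@complex.Im R)) => //; [exact: Im_add|case].
move=> a b.
have cl : fingraph.closed e [pred c | v c 0 == v a 0].
  by move=> c c' /vE; rewrite !inE => ->.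
have := closed_connect cl (conn a b); by rewrite !inE eqxx => h; apply/eqP; rewrite eq_sym -h.
Qed.

End Graph.

(** * Main result *)

Section UniformState.
Context (R : realType) (n : nat).

Lemma nsq_ket (m : 'I_n) : nsq (ket R m) = 1.
Proof. by rewrite nsqE rdot_ket mxE !eqxx. Qed.

Lemma rdot_ket_s (m : 'I_n) : rdot (ket R m) (ket_s R n) = (Num.sqrt n%:R)^-1.
Proof. by rewrite rdot_ket !mxE mulr1. Qed.

Lemma idot_ket_s (m : 'I_n) : idot (ket R m) (ket_s R n) = 0.
Proof. by rewrite idot_ket !mxE mulr1. Qed.

Lemma nsq_ket_s : (0 < n)%N -> nsq (ket_s R n) = 1.
Proof.
move=> n0; rewrite nsq_sum; under eq_bigr do rewrite !mxE mulr1 /= expr0n addr0.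
rewrite sumr_const card_ord exprVn sqr_sqrtr// -[_ *+ n]mulr_natr mulVf//.
by rewrite pnatr_eq0 -lt0n.
Qed.

End UniformState.

Section Orbit.
Context (R : realType) (n : nat) (e : rel 'I_n).
Context (e_sym : symmetric e) (e_conn : connected_graph e).
Context (P : 'M[R[i]]_n) (x : 'I_n -> int) (s : seq int).
Local Notation A := (laplacianC R e).
Local Notation Q := (map_mx conjc P)^T.
Context (xs : forall j, x j \in s) (PQ : P *m Q = 1%:M).
Context (AE : A = Q *m diag_mx (\row_j (x j)%:~R) *m P).
Local Notation T := (subset_sums (dyadic_time R s) (dL s)).

Lemma evol_ket_s t : evol A t *m ket_s R n = ket_s R n.
Proof. by apply: (evol_fix PQ AE); rewrite -scalemxAr laplacian_const scaler0. Qed.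

(** In each eigendirection either the eigenvalue or the sum of exponentials is 0. *)
Lemma laplacian_sum_evol : A *m (\sum_(t <- T) evol A t) = 0.
Proof.
have -> : \sum_(t <- T) evol A t =
    Q *m diag_mx (\row_j \sum_(t <- T) cis (t * (x j)%:~R)) *m P.
  apply/matrixP => a b; rewrite summxE conj_diagE.
  under eq_bigr do rewrite (evolE PQ AE) conj_diagE.
  rewrite exchange_big; apply: eq_bigr => j _ /=.
  by rewrite mulr_sumr mulr_suml.
rewrite {1}AE (conj_diagM PQ).
have -> : \row_j ((x j)%:~R * \sum_(t <- T) cis (t * (x j)%:~R)) = 0 :> 'rV[R[i]]_n.
  apply/rowP => j; rewrite !mxE sum_cis_subset_sums.
  have [->|xj0] := eqVneq (x j) 0; first by rewrite mul0r.
  by rewrite cis_dyadic_time ?mulr0.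
by rewrite raddf0 mulmx0 mul0mx.
Qed.

(** The sum lies in the kernel, hence is a multiple of [s]; the factor is found from the overlap
    with [s], equal to 1 / sqrt n for each orbit point. *)
Lemma sum_orbit (m : 'I_n) :
  \sum_(t <- T) evol A t *m ket R m =
  ((size T)%:R * (Num.sqrt n%:R)^-1)%:C%C *: ket_s R n.
Proof.
have n0 : (0 < n)%N by exact: leq_trans (ltn_ord m).
set V := LHS.
have AV : A *m V = 0.
  by rewrite /V -mulmx_suml mulmxA laplacian_sum_evol mul0mx.
have [c VE] : exists c : R[i], V = c *: ket_s R n.
  exists (V m 0 * (Num.sqrt (n%:R : R))%:C%C); apply/matrixP => a b.
  rewrite ord1 (laplacian_ker e_sym e_conn AV a m) !mxE mulr1 -mulrA -rmorphM.
  by rewrite mulfV ?mulr1// gt_eqF// sqrtr_gt0 ltr0n.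
have sums (f : 'cV[R[i]]_n -> R) (k : R) : {morph f : u v / u + v} -> f 0 = 0 ->
    (forall t, f (evol A t *m ket R m) = k) -> f V = (size T)%:R * k.
  move=> fD f0 ft; rewrite /V (big_morph f fD f0); under eq_bigr do rewrite ft.
  by rewrite big_const_seq count_predT iter_addr_0 mulr_natl.
have rV := sums (rdot (ket_s R n)) (Num.sqrt n%:R)^-1 (rdotDr _) (rdot0r _) _.
have iV := sums (idot (ket_s R n)) 0 (idotDr _) (idot0r _) _.
move: rV iV; rewrite VE; case: c {VE} => c1 c2.
rewrite rdotZr idotZr idot_self -nsqE (nsq_ket_s R n0) !mulr0 subr0 add0r !mulr1 => rV iV.
rewrite rV; last first.
  by move=> t; rewrite -{1}(evol_ket_s t) (Logic.proj1 (evol_dot PQ AE _ _ _)) rdotC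
    rdot_ket_s.
rewrite iV ?complexr0// => t.
by rewrite -{1}(evol_ket_s t) (Logic.proj2 (evol_dot PQ AE _ _ _)) idotC
  idot_ket_s oppr0.
Qed.

End Orbit.

(** Here r = sqrt d, q = sqrt N and M = 2 ^ d_L. With pi <= 4, K is about 8 r, J about r and L about
    9 q / r; the roundings are absorbed by r >= 1 and q / r >= 1, which gives 750 M q phases, plus
    one. *)
Lemma step_counts (R : realType) (r q : R) (M : nat) : 1 <= r -> r <= q -> (0 < M)%N ->
  exists K J L : nat,
  [/\ [/\ (0 < K)%N, (0 < J)%N & (0 < L)%N], (pi *+ 2) ^+ 2 * r ^+ 2 <= K%:R ^+ 2,
    3 * (pi / r / (2 * q^-1) + 1 / (q^-1 * M%:R * (J%:R + 1))) <= L%:R,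
    2 <= q^-1 ^+ 2 * L%:R ^+ 2 * J%:R * (J%:R + 1)
  & (L * (M * (3 * K + 24 * J))).+1%:R <= 1502 * (M%:R / 2) * q].
Proof.
move=> r1 rq M0.
have r0 : 0 < r by lra.
have q0 : 0 < q by lra.
have M1 : 1 <= M%:R :> R by rewrite ler1n.
have pi4 : pi <= 4 :> R by have := @pihalf_lt2 R; lra.
have trunc (y : R) : 0 <= y -> y <= (Num.truncn y).+1%:R <= y + 1.
  move=> y0; have /andP[a b] := truncn_itv y0.
  by rewrite (ltW b) -natr1 lerD2r a.
set K := (Num.truncn (8 * r)).+1; set J := (Num.truncn r).+1.
set L := (Num.truncn (9 * (q / r))).+1.
have qr0 : 0 < q / r by rewrite divr_gt0.
have qr1 : 1 <= q / r by rewrite ler_pdivlMr// mul1r.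
have [|K1 K2] := andP (trunc (8 * r) _); first by lra.
have [|J1 J2] := andP (trunc r _); first by lra.
have [|L1 L2] := andP (trunc (9 * (q / r)) _); first by lra.
rewrite -/K -/J -/L in K1 K2 J1 J2 L1 L2.
have J0 : 0 < J%:R :> R by rewrite ltr0n.
exists K, J, L; split=> //.
- have p0 : 0 <= pi *+ 2 * r by rewrite mulr_ge0 ?(ltW r0)// mulrn_wge0 ?pi_ge0.
  rewrite -exprMn ler_pXn2r ?nnegrE//.
  apply: le_trans K1; rewrite ler_pM2r// mulr2n; lra.
- have -> : pi / r / (2 * q^-1) = pi / 2 * (q / r) by field; rewrite !gt_eqF.
  have : 1 / (q^-1 * M%:R * (J%:R + 1)) <= q / r.
    have -> : 1 / (q^-1 * M%:R * (J%:R + 1)) = q / (M%:R * (J%:R + 1)).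
      by field; rewrite !gt_eqF//; lra.
    rewrite ler_pM2l// lef_pV2 ?posrE//; last by rewrite mulr_gt0; lra.
    by have := ler_wpM2r (ltW (addr_gt0 J0 ltr01)) M1; lra.
  have := ler_wpM2r (ltW qr0) pi4; lra.
- have : 9 / r <= q^-1 * L%:R.
    by rewrite [leRHS]mulrC ler_pdivlMr// mulrAC -mulrA.
  move=> h; have h2 : (9 / r) ^+ 2 <= (q^-1 * L%:R) ^+ 2.
    by rewrite ler_pXn2r// nnegrE ?mulr_ge0 ?invr_ge0 ?ler0n// ltW.
  have JJ : r ^+ 2 <= J%:R * (J%:R + 1).
    by rewrite expr2 ler_pM ?(ltW r0)//; lra.
  have := ler_pM (sqr_ge0 _) (sqr_ge0 _) h2 JJ.
  rewrite -exprMn divfK ?gt_eqF// exprMn mulrA; lra.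
have L3 : L%:R <= 10 * (q / r) by lra.
have S3 : 3 * K%:R + 24 * J%:R <= 75 * r by lra.
rewrite -natr1 !(natrM, natrD).
have : L%:R * (M%:R * (3 * K%:R + 24 * J%:R)) <= 10 * (q / r) * (M%:R * (75 * r)).
  by rewrite ler_pM ?mulr_ge0 ?addr_ge0 ?mulr_ge0 ?ler0n// ler_wpM2l.
have -> : 10 * (q / r) * (M%:R * (75 * r)) = 750 * (M%:R * q).
  by field; rewrite gt_eqF.
have : 1 <= M%:R * q by rewrite mulr_ege1//; lra.
lra.
Qed.

Section Main.
Context (R : realType) (n : nat) (e : rel 'I_n).

Lemma reach_product (m : 'I_n) p y : reach (ket R m) (evol (laplacianC R e)) p y ->
  exists theta t : nat -> R, y =
    (\prod_(k < p)
       (mexp (- 'i%C * (theta (p - k)%N)%:C%C *: proj1 R m) *m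
        mexp (- 'i%C * (t (p - k)%N)%:C%C *: laplacianC R e))) *m ket R m.
Proof.
elim=> [|{}p {}y a b _ [th [t ->]]].
  by exists (fun=> 0), (fun=> 0); rewrite big_ord0 mul1mx.
(* The newest step gets index [p.+1], which the leftmost factor, at k = 0, reads. *)
exists (fun k => if k == p.+1 then a else th k), (fun k => if k == p.+1 then b else t k).
rewrite big_ord_recl subn0 eqxx -mexp_proj1 -[X in _ = X *m _]/(_ *m _) -!mulmxA.
have lt k : (p - k == p.+1)%N = false by rewrite ltn_eqF// ltnS leq_subr.
by under [in RHS]eq_bigr => k _ do rewrite lift0 subSS lt.
Qed.

Lemma reach_uniform (s : seq int) (m : 'I_n) :
  simple_graph e -> connected_graph e ->
  char_poly (laplacian e) = \prod_(x <- s) ('X - x%:P) ->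
  exists2 p : nat, p%:R <= 1502 * ((2 ^ dL s)%:R / 2) * Num.sqrt (n%:R : R) &
    reach (ket R m) (evol (laplacianC R e)) p (ket_s R n).
Proof.
move=> [e_sym e_irr] e_conn sE.
have [P [x [xs PQ AE]]] := laplacian_spectral R e_sym sE.
have n0 : (0 < n)%N by exact: leq_trans (ltn_ord m).
(* A single vertex has degree 0, but there [s] is already [m]. *)
have [nE|n1] := eqVneq n 1%N.
  exists 0%N; first by rewrite !mulr_ge0 ?invr_ge0 ?sqrtr_ge0 ?ler0n.
  suff -> : ket_s R n = ket R m by exact: reach0.
  move: m; rewrite nE => m; apply/matrixP => a b.
  by rewrite !mxE sqrtr1 invr1 mulr1 !ord1 eqxx.
pose d := degree e m; pose r : R := Num.sqrt d%:R; pose q : R := Num.sqrt n%:R.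
have d0 : (0 < d)%N.
  have [b bm] : exists b, b != m.
    apply/existsP; apply: contraNT n1 => /existsPn bm.
    rewrite -{1}(card_ord n) -(card1 m); apply/eqP; apply: eq_card => b.
    by rewrite !inE; have := bm b; rewrite negbK => ->.
  rewrite lt0n; apply: contraNneq bm => d0.
  have em a : e m a = false.
    have := degreeE R e m; rewrite -/d d0 => /esym/eqP.
    rewrite psumr_eq0 => [/allP/(_ a (mem_index_enum a))|//].
    by rewrite pnatr_eq0; case: (e m a).
  have cl : fingraph.closed e (pred1 m).
    move=> a a' aa'; rewrite !inE; have [am|_] := eqVneq a m.
      by rewrite am em in aa'.
    by have [am|//] := eqVneq a' m; rewrite am e_sym em in aa'.
  by have := closed_connect cl (e_conn m b); rewrite !inE eqxx => <-.
have dn : (d <= n)%N.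
  by rewrite -[leqRHS]card_ord max_card.
have r2 : r ^+ 2 = d%:R by rewrite sqr_sqrtr.
have r1 : 1 <= r by rewrite -sqrtr1 ler_wsqrtr// ler1n.
have rq : r <= q by rewrite ler_wsqrtr// ler_nat.
have r0 : 0 < r by lra.
have pi4 : pi <= 4 :> R by have := @pihalf_lt2 R; lra.
have [K [J [L [[K0 J0 L0] Kr H1 H2 cnt]]]] := step_counts r1 rq (expn_gt0 2 (dL s)).
pose T := subset_sums (dyadic_time R s) (dL s).
have sT : size T = (2 ^ dL s)%N by exact: size_subset_sums.
exists (L * (size T * (3 * K + 24 * J))).+1; first by rewrite sT.
have Ud (t : R) :
    nsq (evol (laplacianC R e) t *m ket R m - cis (t * d%:R) *: ket R m) <= t ^+ 2 * d%:R.
  have := evol_lip PQ AE t d%:R (ket R m).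
  by rewrite [X in _ <= _ * X](laplacian_ket R e_sym e_irr m).
apply: (@reach_target R n (ket R m) (evol (laplacianC R e)) _ _ _ _ d%:R _ Ud _
  (ket_s R n) (q^-1) (pi / r) (pi / d%:R / 4) T).
- exact: nsq_ket.
- exact: (evol0 PQ AE).
- exact: (evolD PQ AE).
- by move=> t u v; case: (evol_dot PQ AE t u v).
- exact: ler0n.
- exact: (evol_period PQ AE).
- exact: nsq_ket_s.
- exact: (evol_ket_s PQ AE).
- exact: rdot_ket_s.
(* A quarter of pi / d is a legal hop even for d = 1, since pi / 4 <= 1. *)
- have d1 : 1 <= d%:R :> R by rewrite ler1n.
  have -> : (pi / d%:R / 4) ^+ 2 * d%:R = (pi / 4) ^+ 2 / d%:R :> R.
    by field; rewrite gt_eqF// ltr0n.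
  rewrite ler_pdivrMr ?ltr0n// mul1r; apply: le_trans d1.
  by rewrite exprn_ile1// ?divr_ge0 ?pi_ge0// ler_pdivrMr// mul1r.
- by rewrite divr_ge0 ?pi_ge0// ltW.
(* At time pi / d the comparison phase is exp(- i pi) = - 1, so the pair has norm at most (pi / d)
   sqrt d = pi / r. *)
- have := Ud (pi / d%:R); have -> : pi / d%:R * d%:R = pi :> R.
    by rewrite divfK// pnatr_eq0 -lt0n.
  have -> : (pi / d%:R / 4) *+ 4 = pi / d%:R :> R.
    by rewrite -[LHS]mulr_natr divfK// pnatr_eq0.
  rewrite cispi scaleN1r opprK addrC => /le_trans; apply.
  by rewrite -r2 le_eqVlt; apply/orP; left; apply/eqP; field; rewrite gt_eqF.
- exact: (sum_orbit e_sym e_conn xs PQ AE).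
- by rewrite -r2.
- exact: K0.
- exact: J0.
- exact: L0.
- by rewrite invr_gt0; lra.
- by rewrite sT expn_gt0.
- by rewrite sT.
- exact: H2.
Qed.

End Main.

(* The ordered product prod_{k=1}^p X_k = X_p ... X_1 is written
   \prod_(k < p) X_(p - k). *)
Theorem theorem1 (R : realType) :
  exists C : R, 0 < C /\
  forall (n : nat) (e : rel 'I_n),
    simple_graph e -> connected_graph e -> vertex_transitive e ->
    forall s : seq int,
      char_poly (laplacian e) = \prod_(x <- s) ('X - x%:P) ->
    forall m : 'I_n,
    exists (p : nat) (gamma : R) (theta t : nat -> R),
      (p%:R <= C * (2 : R) ^ ((dL s)%:Z - 1) * Num.sqrt (n%:R : R)) /\
      ket_s R n =
        cexp (- 'i%C * gamma%:C%C) *: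
          ((\prod_(k < p)
              (mexp (- 'i%C * (theta (p - k)%N)%:C%C *: proj1 R m) *m
               mexp (- 'i%C * (t (p - k)%N)%:C%C *: laplacianC R e)))
           *m ket R m).
Proof.
exists 1502; split=> [|n e simple conn _ s sE m]; first by rewrite ltr0n.
have [p pB reach_p] := reach_uniform R m simple conn sE.
have [theta [t kE]] := reach_product reach_p.
exists p, 0, theta, t; split; last by rewrite cexp_cis cis0 scale1r.
(* The integer exponent makes 2 ^ (d_L - 1) equal to 2 ^ d_L / 2 also when d_L = 0. *)
by move: pB; rewrite expfzDr ?pnatr_eq0// -exprnP natrX.
Qed.
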